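(* Let $a,b\ge 2$ be integers and $n=ab$. The $(1^b)$-summand $U_{(1^b),a}$ of the generalized Foulkes module $F_{(1^b)}^a$ restricted to $S_b\times S_{n-b}$ (as defined in the context) satisfies $$U_{(1^b),a}\cong\bigoplus_{\lambda\vdash b}S^{\lambda^\perp}\times F_\lambda^{a-1}$$ as $S_b\times S_{n-b}$-modules. In particular, for $a=2$, $$U_{(1^b),2}\cong\bigoplus_{\lambda\vdash b}S^{\lambda^\perp}\times S^\lambda.$$
   Context: All modules are over $\mathbb{C}$. $\lambda^\perp$ denotes the conjugate partition of $\lambda$. For a partition $\nu\vdash b$, $S^\nu$ is the Specht module of $S_b$ ($S^{(b)}$ trivial, $S^{(1^b)}$ sign). For integers $a\ge1$, $b\ge 2$, $S_a\wr S_b\le S_{ab}$ is the stabilizer of a partition of $\{1,\dots,ab\}$ into $b$ blocks of size $a$; its base group $S_a^b$ has quotient $S_b$, and $\mathrm{Inf}_{S_b}^{S_a\wr S_b}S^\nu$ is $S^\nu$ viewed as an $S_a\wr S_b$-module via this quotient. The generalized Foulkes module is the $S_{ab}$-module $F_\nu^a=\mathrm{Inf}_{S_b}^{S_a\wr S_b}S^\nu\uparrow^{S_{ab}}$ (induced module); in particular $F_\nu^1=S^\nu$. For an $S_k$-module $M$ and an $S_{n-k}$-module $N$, $M\times N$ is the (outer tensor product) $S_k\times S_{n-k}$-module. Concrete model of $F_\nu^a$ ($a,b\ge2$, $n=ab$): let $H=H_b^a$ be the set of ordered partitions $X=(X_1,\dots,X_b)$ of $\{1,\dots,n\}$ into $b$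 sets of size $a$; $S_n$ acts on $H$ by permuting letters. A $\nu$-tableau $t$ is a bijective filling of the diagram of $\nu$ by $1,\dots,b$; $t_X$ is the diagram of $\nu$ filled by replacing $l$ in $t$ with $X_l$; the ''tabloid'' $\{t_X\}$ is its row-equivalence class. Let $V$ be the $\mathbb{C}$-vector space with formal basis all such ''tabloids'' of shape $\nu$, and let $e_{t_X}=\sum_{\pi\in C_t}\mathrm{sgn}(\pi)\{(\pi t)_X\}\in V$, where $C_t\le S_b$ is the column stabilizer of $t$. $S_n$ acts by $g\{t_X\}=\{t_{gX}\}$, so $g e_{t_X}=e_{t_{gX}}$. The span of $\{e_{t_X}\mid X\in H\}$ (for any fixed $t$) is isomorphic to $F_\nu^a$ and is taken as $F_\nu^a$. The $(1^b)$-summand: let $P_{(1^b)}$ be the set of $X\in H$ such that every $X_i$ contains exactly one element of $\{1,\dots,b\}$. Then $U_{\nu,a}$ is the $S_b\times S_{n-b}$-submodule of $F_\nu^a\downarrow_{S_b\times S_{n-b}}$ generated by (equivalently, spanned by) $\{e_{t_X}\mid X\in P_{(1^b)}\}$ for any $\nu$-tableau $t$, where $S_b=\mathrm{Sym}\{1,\dots,b\}$ and $S_{n-b}=\mathrm{Sym}\{b+1,\dots,n\}$. *)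

(* Defs.v *)
From HB Require Import structures.
From mathcomp Require Import all_boot all_order all_algebra.
From mathcomp Require Import all_fingroup all_solvable all_character.
From mathcomp Require Export reals complex.

Set Implicit Arguments.
Unset Strict Implicit.
Unset Printing Implicit Defensive.

Import GroupScope GRing.Theory.
Local Open Scope ring_scope.

(* Permutations compose from left to right and representations act on row
   vectors from the right, so a left module over the symmetric group in the
   usual convention is a right module here. *)

Section Representations.

Variable F : fieldType.

Definition pullback_repr (aT rT : finGroupType) (D : {group aT})
    (f : {morphism D >-> rT}) n (rG : mx_representation F [set: rT] n) :
  mx_representation F D n :=
  subg_repr (morphpre_repr f rG)
    (introT subsetP (fun x Dx => mem_morphpre Dx (in_setT (f x)))).

(* The S_k x S_l-module M x N: the tensor product, the first factor acting on M
   and the second one on N. *)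
Definition outer_repr (gT1 gT2 : finGroupType) n1 n2
    (rG1 : mx_representation F [set: gT1] n1)
    (rG2 : mx_representation F [set: gT2] n2) :
  mx_representation F [set: gT1 * gT2] (n1 * n2) :=
  prod_repr (pullback_repr (@fst_morphism gT1 gT2) rG1)
            (pullback_repr (@snd_morphism gT1 gT2) rG2).

Section Induction.

Variables (gT : finGroupType) (H : {group gT}) (n : nat).
Variable rH : mx_representation F H n.

(* M (x)_{FH} FG is the direct sum of the M (x) x_i, with x_i ranging over
   representatives of the right cosets of H in G = gT, and
   (m (x) x_i) g = m h (x) x_j when x_i g = h x_j with h in H. *)
Definition coset_elt (i : 'I_#|rcosets H [set: gT]|) : gT := repr (enum_val i).

Definition ind_block (g : gT) (i j : 'I_#|rcosets H [set: gT]|) : 'M[F]_n :=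
  let h := (coset_elt i * g * (coset_elt j)^-1)%g in
  if h \in H then rH h else 0.

Definition ind_mx (g : gT) := \mxblock_(i, j) ind_block g i j.

Lemma coset_elt_rcoset i : H :* coset_elt i = enum_val i.
Proof.
have /rcosetsP[x _ Dx] := enum_valP i.
by rewrite /coset_elt Dx rcoset_repr.
Qed.

Lemma coset_eltP x : exists i, (x * (coset_elt i)^-1)%g \in H.
Proof.
have Hx : H :* x \in rcosets H [set: gT] by apply/rcosetsP; exists x.
exists (enum_rank_in Hx (H :* x)).
by rewrite -mem_rcoset coset_elt_rcoset enum_rankK_in // rcoset_refl.
Qed.

Lemma coset_elt_inj x i j :
  (x * (coset_elt i)^-1)%g \in H -> (x * (coset_elt j)^-1)%g \in H -> i = j.
Proof.
rewrite -!mem_rcoset => /rcoset_eqP Ei /rcoset_eqP Ej.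
by apply: enum_val_inj; rewrite -!coset_elt_rcoset -Ei -Ej.
Qed.

Lemma ind_mx_repr : mx_repr [set: gT] ind_mx.
Proof.
split=> [|g1 g2 _ _].
  rewrite -[RHS](@mxdiagZ F _ (fun=> n)); apply: eq_mxblock => i j.
  rewrite /ind_block mulg1; case: eqP => [<-|neq_ij].
    by rewrite mulgV group1 repr_mx1 conform_mx_id.
  case: ifP => // Hij; case: neq_ij.
  by apply: (@coset_elt_inj (coset_elt i)); rewrite ?mulgV ?group1.
rewrite /ind_mx mul_mxblock; apply: eq_mxblock => i j.
have [k Hk] := coset_eltP (coset_elt i * g1)%g.
rewrite (bigD1 k) //= big1 ?addr0 => [|l neq_lk]; last first.
  rewrite /ind_block; case: ifP => [Hl|_]; last by rewrite mul0mx.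
  by rewrite (coset_elt_inj Hl Hk) eqxx in neq_lk.
rewrite /ind_block Hk.
have -> : (coset_elt i * (g1 * g2) * (coset_elt j)^-1 =
  (coset_elt i * g1 * (coset_elt k)^-1) *
  (coset_elt k * g2 * (coset_elt j)^-1))%g by rewrite !mulgA mulgKV.
rewrite groupMl //; case: ifP => H2; last by rewrite mulmx0.
by rewrite repr_mxM.
Qed.

Definition ind_repr := MxRepresentation ind_mx_repr.

End Induction.

Section PermutationModule.

Variables (gT : finGroupType) (T : finType) (to : {action gT &-> T}).

Definition perm_module_mx (g : gT) : 'M[F]_#|T| :=
  \matrix_(i, j) (to (enum_val i) g == enum_val j)%:R.

Lemma perm_module_mx_repr : mx_repr [set: gT] perm_module_mx.
Proof.
split=> [|g h _ _]; apply/matrixP=> i j; rewrite !mxE.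
  by rewrite act1 (inj_eq enum_val_inj).
rewrite (bigD1 (enum_rank (to (enum_val i) g))) //= big1 => [|k neq_k].
  by rewrite !mxE enum_rankK eqxx mul1r addr0 actM.
rewrite !mxE; case: eqP => [Ek|_]; last by rewrite mul0r.
by rewrite Ek enum_valK eqxx in neq_k.
Qed.

Definition perm_module := MxRepresentation perm_module_mx_repr.

Definition basis_vec (x : T) : 'rV[F]_#|T| := delta_mx 0 (enum_rank x).

Lemma basis_vecJ x g : basis_vec x *m perm_module g = basis_vec (to x g).
Proof.
rewrite -rowE; apply/rowP=> j; rewrite !mxE enum_rankK eqxx /=.
by rewrite -(inj_eq enum_val_inj) enum_rankK eq_sym.
Qed.

End PermutationModule.

End Representations.

Section Partitions.

Variable b : nat.

(* Partitions of b, padded with zeros to b parts. *)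
Definition is_part (l : {ffun 'I_b -> 'I_b.+1}) : bool :=
  [forall i : 'I_b, forall j : 'I_b, (i <= j)%N ==> (l j <= l i)%N] &&
  (\sum_i l i == b)%N.

Definition intpart := {l : {ffun 'I_b -> 'I_b.+1} | is_part l}.

Definition conj_fun (l : {ffun 'I_b -> 'I_b.+1}) : {ffun 'I_b -> 'I_b.+1} :=
  [ffun j : 'I_b => inord #|[set i : 'I_b | (j < l i)%N]|].

Lemma conj_funE l j : conj_fun l j = #|[set i : 'I_b | (j < l i)%N]| :> nat.
Proof. by rewrite ffunE inordK // ltnS -[leqRHS]card_ord max_card. Qed.

Lemma conj_fun_part l : is_part l -> is_part (conj_fun l).
Proof.
case/andP=> _ /eqP sum_l; apply/andP; split.
  apply/forallP=> i; apply/forallP=> j; apply/implyP=> le_ij.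
  rewrite !conj_funE subset_leq_card //; apply/subsetP=> k.
  by rewrite !inE; apply: leq_ltn_trans.
under eq_bigr => j _ do rewrite conj_funE -sum1_card big_mkcond /=.
rewrite exchange_big /= -[X in _ == X]sum_l; apply/eqP/eq_bigr => i _.
rewrite -big_mkcond /=; under eq_bigl do rewrite inE.
have le_li : (l i <= b)%N by rewrite -ltnS ltn_ord.
by rewrite (big_ord_narrow_cond (P := xpredT) (F := fun=> 1%N) le_li)
     sum1_card card_ord.
Qed.

Definition conj_part (l : intpart) : intpart :=
  exist _ (conj_fun (val l)) (conj_fun_part (valP l)).

Lemma ones_part : is_part [ffun => inord 1].
Proof.
apply/andP; split; first by do 2![apply/forallP=> ?]; rewrite !ffunE leqnn implybT.
under eq_bigr => i _ do rewrite ffunE inordK ?ltnS ?(leq_ltn_trans _ (ltn_ord i)) //.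
by rewrite sum1_card card_ord.
Qed.

(* (1^b) *)
Definition ones : intpart := exist (fun l => is_part l) _ ones_part.

(* The cell c lies in row (val c).1 and column (val c).2. *)
Definition cell (l : intpart) :=
  {c : 'I_b * 'I_b | (c.2 < val l c.1)%N}.

Definition is_tableau (l : intpart) (t : {ffun cell l -> 'I_b}) : bool :=
  injectiveb t && [forall k, exists c, t c == k].

Definition col_stab (l : intpart) (t : {ffun cell l -> 'I_b}) : {set 'S_b} :=
  [set p : 'S_b | [forall j, p @: [set t c | c : cell l & (val c).2 == j] ==
                             [set t c | c : cell l & (val c).2 == j]]].

End Partitions.

Section Tabloids.

Variables (F : fieldType) (b : nat).
Variables (gT : finGroupType) (A : finType) (to : {action gT &-> A}).

(* Row-equivalence classes of fillings of a diagram with distinct entries in A: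
   such a class is recorded by the set of entries of each row. The vector space
   on all such records contains the one on the classes of any fixed shape. *)
Definition tabloid := {ffun 'I_b -> {set A}}.

Definition tabloid_of (l : intpart b) (f : cell l -> A) : tabloid :=
  [ffun i => [set f c | c : cell l & (val c).1 == i]].

Definition tabloid_act (T : tabloid) (g : gT) : tabloid :=
  [ffun i => (to^*)%act (T i) g].

Lemma tabloid_act1 T : tabloid_act T 1 = T.
Proof. by apply/ffunP=> i; rewrite ffunE act1. Qed.

Lemma tabloid_actM T g h :
  tabloid_act T (g * h)%g = tabloid_act (tabloid_act T g) h.
Proof. by apply/ffunP=> i; rewrite !ffunE actM. Qed.

Definition tabloid_action : {action gT &-> tabloid} :=
  TotalAction tabloid_act1 tabloid_actM.

Definition tabloid_repr : mx_representation F [set: gT] #|tabloid| :=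
  perm_module F tabloid_action.

(* e_{t_X}, where t_X is t with each entry k replaced by X k. *)
Definition polytabloid (l : intpart b) (t : {ffun cell l -> 'I_b})
    (X : {ffun 'I_b -> A}) : 'rV[F]_#|tabloid| :=
  \sum_(p in col_stab t)
    (-1) ^+ p *: basis_vec F (tabloid_of (fun c => X (p (t c)))).

Lemma polytabloidJ l (t : {ffun cell l -> 'I_b}) X g :
  polytabloid t X *m tabloid_repr g = polytabloid t [ffun k => to (X k) g].
Proof.
rewrite mulmx_suml; apply: eq_bigr => p _; rewrite -scalemxAl basis_vecJ.
congr (_ *: basis_vec _ _); apply/ffunP=> i; rewrite !ffunE /=.
rewrite setactE -imset_comp; apply: eq_imset => c /=.
by rewrite !ffunE.
Qed.

End Tabloids.

Section Specht.

Variables (F : fieldType) (b : nat) (l : intpart b).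

Definition specht_space :=
  (\sum_(t : {ffun cell l -> 'I_b} | is_tableau t)
     cyclic_mx (tabloid_repr F b 'P) (polytabloid F t (finfun id)))%MS.

Lemma specht_module : mxmodule (tabloid_repr F b 'P) specht_space.
Proof. by apply: sumsmx_module => t _; apply: cyclic_mx_module. Qed.

(* S^l, the submodule generated by the polytabloids e_t. *)
Definition specht := submod_repr specht_module.

End Specht.

Section Foulkes.

Variables (F : fieldType) (a b : nat).

Definition block (k : 'I_b) : {set 'I_(a * b)} :=
  [set x : 'I_(a * b) | x %/ a == k]%N.

(* S_a wr S_b *)
Definition wreath : {group 'S_(a * b)} :=
  ('N([set block k | k : 'I_b] | 'P^* ))%G.

(* The quotient map S_a wr S_b -> S_b; the condition 0 < a only makes it trivial
   in the degenerate case of empty blocks. *)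
Definition wreath_quo (g : 'S_(a * b)) : 'S_b :=
  odflt 1%g
    [pick s : 'S_b | (0 < a)%N && [forall k, g @: block k == block (s k)]].

Lemma block_inj : (0 < a)%N -> injective block.
Proof.
move=> a_gt0 k m Ekm.
have lt_ka : (k * a < a * b)%N by rewrite mulnC ltn_pmul2l.
have: Ordinal lt_ka \in block k by rewrite inE /= mulnK.
by rewrite Ekm inE /= mulnK // => /eqP/val_inj.
Qed.

Lemma wreath_quoP g : (0 < a)%N -> g \in wreath ->
  forall k, g @: block k = block (wreath_quo g k).
Proof.
move=> a_gt0 Wg; rewrite /wreath_quo.
case: pickP => [s /andP[_ /forallP/(_ _)/eqP //]|no_s].
have ex k : exists m, g @: block k == block m.
  have := astabs_act (block k) Wg; rewrite imset_f // => /imsetP[m _ Dm].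
  exists m; rewrite -Dm /= setactE; apply/eqP; exact: eq_imset.
pose f k := xchoose (ex k).
have fP k : g @: block k = block (f k) by apply/eqP/(xchooseP (ex k)).
have f_inj : injective f.
  move=> k m Ef; apply: (block_inj a_gt0); apply: (imset_inj (@perm_inj _ g)).
  by rewrite !fP Ef.
have := no_s (perm f_inj); rewrite a_gt0 /= => /negP[].
by apply/forallP=> k; rewrite permE fP.
Qed.

Lemma wreath_quoM : {in wreath &, {morph wreath_quo : g h / (g * h)%g}}.
Proof.
move=> g h Wg Wh; have [a0|a_gt0] := posnP a.
  have quo1 x : wreath_quo x = 1%g.
    by rewrite /wreath_quo; case: pickP => //= s; rewrite [X in (0 < X)%N]a0.
  by rewrite !quo1 mulg1.
apply/permP=> k; apply: (block_inj a_gt0).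
rewrite -wreath_quoP ?groupM // permM -!wreath_quoP // -imset_comp.
by apply: eq_imset => x /=; rewrite permM.
Qed.

Canonical wreath_quo_morphism := Morphism wreath_quoM.

(* F_l^a, the inflation of S^l to S_a wr S_b induced to S_{ab}. *)
Definition foulkes (l : intpart b) :=
  ind_repr (pullback_repr wreath_quo_morphism (specht F l)).

End Foulkes.

(* The letters 1..b are those of 'I_(b + m) below b. *)
Section Young.

Variables b m : nat.

Definition young_fun (st : 'S_b * 'S_m) (x : 'I_(b + m)) : 'I_(b + m) :=
  match split x with
  | inl i => lshift m (st.1 i)
  | inr j => rshift b (st.2 j)
  end.

Lemma young_fun_inj st : injective (young_fun st).
Proof.
apply: (can_inj (g := young_fun (st^-1)%g)) => x.
rewrite /young_fun; case: (splitP x) => [i Dx|j Dx].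
  rewrite (unsplitK (inl _)) permK; exact: val_inj.
rewrite (unsplitK (inr _)) permK; exact: val_inj.
Qed.

Definition young (st : 'S_b * 'S_m) : 'S_(b + m) := perm (@young_fun_inj st).

Lemma youngM : {in [set: 'S_b * 'S_m] &, {morph young : x y / (x * y)%g}}.
Proof.
move=> x y _ _; apply/permP=> k; rewrite permM !permE /young_fun.
by case: (split k) => i; rewrite ?(unsplitK (inl _)) ?(unsplitK (inr _)) permM.
Qed.

Canonical young_morphism := Morphism youngM.

End Young.

(* The tabloid model of F_nu^a and its (1^b)-summand. The n = ab letters are
   'I_(b + a.-1 * b), with S_b and S_{n-b} = S_{(a-1)b} acting through young. *)
Section Summand.

Variables (F : fieldType) (a b : nat) (nu : intpart b).
Variable t : {ffun cell nu -> 'I_b}.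

Local Notation m := (a.-1 * b)%N.
Local Notation V := (tabloid_repr F b ('P^* : {action 'S_(b + m) &-> _})).
Local Notation e := (polytabloid F t).

(* H_b^a *)
Definition is_ordpart (X : {ffun 'I_b -> {set 'I_(b + m)}}) : bool :=
  [&& [forall k, #|X k| == a],
      [forall k, forall k', (k != k') ==> [disjoint X k & X k']]
    & \bigcup_k X k == [set: 'I_(b + m)]].

(* P_(1^b) *)
Definition is_transversal_ordpart X : bool :=
  is_ordpart X &&
  [forall k, #|X k :&: [set lshift m i | i : 'I_b]| == 1%N].

Definition foulkes_space := (\sum_(X | is_ordpart X) <<e X>>)%MS.

Lemma is_ordpartJ X (g : 'S_(b + m)) :
  is_ordpart X -> is_ordpart [ffun k => ('P^*)%act (X k) g].
Proof.
have actE Y : ('P^*)%act Y g = g @: Y.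
  by rewrite /= setactE; apply: eq_imset.
case/and3P=> /forallP cardX /forallP disX /eqP covX; apply/and3P; split.
- by apply/forallP=> k; rewrite ffunE actE card_imset //; apply: perm_inj.
- apply/forallP=> k; apply/forallP=> k'; apply/implyP=> neq.
  rewrite !ffunE !actE -setI_eq0 -imsetI; last by move=> ? ? _ _; apply: perm_inj.
  have /forallP/(_ k')/implyP/(_ neq) := disX k.
  by rewrite -setI_eq0 => /eqP->; rewrite imset0.
apply/eqP/setP=> x; rewrite inE; apply/bigcupP.
have: (g^-1)%g x \in \bigcup_k X k by rewrite covX inE.
case/bigcupP=> k _ Xk; exists k => //; rewrite ffunE actE.
by apply/imsetP; exists ((g^-1)%g x); rewrite ?permKV.
Qed.

Lemma foulkes_space_module : mxmodule V foulkes_space.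
Proof.
apply/mxmoduleP=> g _; rewrite sumsmxMr; apply/sumsmx_subP=> X HX.
rewrite (eqmxMr _ (genmxE _)) polytabloidJ.
by apply: (sumsmx_sup _ (is_ordpartJ g HX)); rewrite genmxE.
Qed.

Definition foulkes_restr := pullback_repr (@young_morphism b m) V.

(* U_{nu,a}, the submodule generated by the e_{t_X} with X in P_(1^b). *)
Definition summand_space :=
  (\sum_(X | is_transversal_ordpart X) cyclic_mx foulkes_restr (e X))%MS.

Lemma summand_space_sub : (summand_space <= foulkes_space)%MS.
Proof.
apply/sumsmx_subP=> X /andP[HX _]; apply: cyclic_mx_sub.
  apply/mxmoduleP=> g _; exact: (mxmoduleP foulkes_space_module).
by apply: (sumsmx_sup _ HX); rewrite genmxE.
Qed.

Lemma summand_module : mxmodule foulkes_restr summand_space.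
Proof. by apply: sumsmx_module => X _; apply: cyclic_mx_module. Qed.

Definition summand := submod_repr summand_module.

End Summand.

(* Main.v *)
(* Attach to g in S_{(a-1)b} the set partition X_g with blocks
   {k} u g(k-th standard block), k = 1..b. The vectors e_{t_{X_g}} span the summand,
   depend only on the coset of g modulo the base group S_{a-1}^b, and are independent
   for distinct cosets; (sigma, tau) sends e_{t_{X_g}} to sgn(sigma) e_{t_{X_g'}} with
   g' = w g tau and w any lift of sigma^-1 to the wreath product. Hence the summand is
   induced from the bimodule C[S_b] with its left action twisted by the sign, and the
   claim is the decomposition of that bimodule.

   Concretely, an isomorphism J from S^l to the dual of sgn (x) S^{l'} is an invariant
   of S^{l'} (x) S^l up to sign; moving it by g into S^{l'} (x) F_l gives vectors that
   obey the same rule. Jointly over l these are independent since an element of C[S_b]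
   that kills every Specht module is zero, and dimensions agree as sum_l (f^l)^2 = b!.

   Both facts need the Specht modules to be all the irreducible modules. They are
   irreducible because the column antisymmetrizer of a tableau has rank one on S^l and
   is not nilpotent there, they are pairwise distinct by dominance, and there are at
   least as many partitions as conjugacy classes. S^l is characterized among them by
   not being killed by the column antisymmetrizer nor by the row symmetrizer of a
   tableau of shape l; dualizing and twisting by the sign exchanges the two. *)

From HB Require Import structures.
Require Import Defs.
From mathcomp Require Import all_boot all_algebra all_fingroup all_solvable all_character.

Set Implicit Arguments.
Unset Strict Implicit.
Unset Printing Implicit Defensive.

Import GroupScope GRing.Theory Num.Theory.
Local Open Scope ring_scope.

(** * Tensor products, direct sums and induction *)

Section Flattening.

Variable F : fieldType.

(** For one-row matrices [tprod] is [trow] above an empty block of rows, so this is the top block of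
    [tprodE]. *)
Lemma trow_tprod n1 p1 n2 p2 (u : 'rV[F]_n1) (v : 'rV[F]_n2)
    (S : 'M[F]_(n1, p1)) (B : 'M[F]_(n2, p2)) :
  trow (u *m S) (v *m B) = trow u v *m tprod S B.
Proof.
have usubmx1 k (w : 'rV[F]_k) : usubmx (w : 'M[F]_(1 + 0, k)) = w.
  by apply/rowP=> j; rewrite mxE; congr (w _ j); apply/val_inj.
have tprod_row k l (w : 'rV[F]_k) (x : 'rV[F]_l) :
    tprod w x = col_mx (trow w x) (0 : 'M_(0 * 1, _)).
  by rewrite /= usubmx1.
have := tprodE u S v B; rewrite !tprod_row.
move/(congr1 (fun X => usubmx (X : 'M[F]_(1 + 0 * 1, _)))).
by rewrite (mul_col_mx (trow u v)) !col_mxKu.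
Qed.

(** The tensor $\sum_k e_k \otimes A_k$, with $A_k$ the $k$-th row, in the coordinates on which
    [tprod] acts. *)
Definition flat_mx m n (A : 'M[F]_(m, n)) : 'rV[F]_(m * n) :=
  \sum_k trow (delta_mx 0 k : 'rV_m) (row k A).

Lemma flat_mx_is_linear m n : linear (@flat_mx m n).
Proof.
move=> a A B; rewrite scaler_sumr -big_split; apply: eq_bigr => k _ /=.
by rewrite linearP /= linearP.
Qed.

HB.instance Definition _ m n :=
  GRing.isSemilinear.Build _ _ _ _ (@flat_mx m n)
    (GRing.semilinear_linear (@flat_mx_is_linear m n)).

(** Turns the action on a tensor product into two-sided multiplication, so that a twisted
    intertwining relation of [A] can be applied directly. *)
Lemma flat_mx_tprod m m' n n' (A : 'M[F]_(m, n)) (S : 'M[F]_(m, m'))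
    (B : 'M[F]_(n, n')) :
  flat_mx A *m tprod S B = flat_mx (S^T *m A *m B).
Proof.
transitivity (\sum_k \sum_l S k l *: trow (delta_mx 0 l : 'rV_m') (row k A *m B)).
  rewrite mulmx_suml; apply: eq_bigr => k _; rewrite -trow_tprod -rowE.
  rewrite [row k S]row_sum_delta -trowbE linear_sum; apply: eq_bigr => l _.
  by rewrite linearZ mxE.
rewrite exchange_big; apply: eq_bigr => l _ /=.
have -> : row l (S^T *m A *m B) = \sum_k S k l *: (row k A *m B).
  rewrite -mulmxA row_mul mulmx_sum_row; apply: eq_bigr => k _.
  by rewrite !mxE row_mul.
by rewrite linear_sum; apply: eq_bigr => k _; rewrite linearZ.
Qed.

Lemma flat_mx_inj m n : injective (@flat_mx m n).
Proof.
apply: raddf_inj => A A0; apply/row_matrixP => k; rewrite row0.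
(* Contracting the first factor with the $k$-th dual basis vector leaves row $k$ of [A]. *)
have: flat_mx A *m tprod (delta_mx k 0 : 'cV_m) 1%:M = 0 by rewrite A0 mul0mx.
rewrite flat_mx_tprod trmx_delta -rowE mulmx1 /flat_mx big_ord1 /=.
rewrite row_id !mxE !eqxx scale1r => /(congr1 (fun X => lsubmx (X : 'M_(_, n + 0 * n)))).
by rewrite row_mxKl linear0.
Qed.

End Flattening.

(** * Gluing intertwiners and comparing modules *)

Section Similarity.

Variables (F : fieldType) (gT : finGroupType) (G : {group gT}).

Lemma rdegree_dsum (I : Type) (r : seq I) (W : I -> representation F G) :
  rdegree (\big[dadd_grepr/grepr0]_(i <- r) W i) = (\sum_(i <- r) rdegree (W i))%N.
Proof. exact: (big_morph (@rdegree F gT G)). Qed.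

(** Glues maps with a common source into one map to the direct sum. [M] is any family of matrices,
    so the source carries no representation structure. *)
Lemma dsum_intertwine (I : eqType) (r : seq I) (W : I -> representation F G) n
    (M : gT -> 'M[F]_n) (P : forall i, 'M[F]_(n, rdegree (W i))) :
  (forall i g, g \in G -> M g *m P i = P i *m W i g) ->
  exists2 Q : 'M[F]_(n, rdegree (\big[dadd_grepr/grepr0]_(i <- r) W i)),
    forall g, g \in G ->
      M g *m Q = Q *m (\big[dadd_grepr/grepr0]_(i <- r) W i) g &
    forall u : 'rV_n, u *m Q = 0 -> forall i, i \in r -> u *m P i = 0.
Proof.
move=> homP; elim: r => [|i r [Q homQ injQ]].
  by rewrite big_nil; exists 0 => // g _; rewrite mul0mx mulmx0.
rewrite big_cons; exists (row_mx (P i) Q) => [g Gg|u].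
  by rewrite mul_mx_row mul_row_block !mulmx0 addr0 add0r homP ?homQ.
rewrite mul_mx_row -[RHS]row_mx0 => /eq_row_mx[uP uQ] j.
by rewrite inE => /predU1P[->|/(injQ _ uQ)].
Qed.

(** [B] and [Q] are bijections from the same source onto the two modules; the isomorphism is the
    inverse of [Q] followed by [B] in coordinates of [U]. *)
Lemma mx_rsim_common d (rG : mx_representation F G d) (U : 'M_d)
    (modU : mxmodule rG U) n (rW : mx_representation F G n) k
    (M : gT -> 'M[F]_k) (B : 'M[F]_(k, d)) (Q : 'M[F]_(k, n)) :
  (B :=: U)%MS -> row_free B -> (forall g, g \in G -> M g *m B = B *m rG g) ->
  k = n -> row_free Q -> (forall g, g \in G -> M g *m Q = Q *m rW g) ->
  mx_rsim (submod_repr modU) rW.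
Proof.
move=> defU freeB homB def_n; rewrite -{n}def_n in rW Q * => freeQ homQ.
have rankU: k = \rank U by rewrite -defU (eqP freeB).
pose C := in_submod U B.
have valC : val_submod C = B by rewrite in_submodK ?defU.
have homC g : g \in G -> M g *m C = C *m submod_repr modU g.
  move=> Gg; apply: (can_inj (val_submodK (U := U))); rewrite val_submodJ // valC -homB //.
  by rewrite val_submodE -mulmxA -val_submodE valC.
have freeC : row_free C.
  by rewrite /row_free mxrank_in_submod // defU.
apply: mx_rsim_sym.
move: (submod_repr modU) homC freeC; rewrite /C {valC C}.
move: (in_submod U B); rewrite -rankU => C rU homC freeC.
rewrite row_free_unit in freeQ; rewrite row_free_unit in freeC.
exists (invmx Q *m C) => // [|g Gg].
  by rewrite row_free_unit unitmx_mul unitmx_inv freeQ.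
have -> : rW g = invmx Q *m (M g *m Q) by rewrite homQ // mulKmx.
by rewrite -!mulmxA (mulKVmx freeQ) homC.
Qed.

Lemma mx_rsim_dsum_congr (I : Type) (r : seq I) (W W' : I -> representation F G) :
  (forall i, mx_rsim (W i) (W' i)) ->
  mx_rsim (\big[dadd_grepr/grepr0]_(i <- r) W i)
          (\big[dadd_grepr/grepr0]_(i <- r) W' i).
Proof.
move=> simW; elim: r => [|i r IHr]; first by rewrite !big_nil; apply: mx_rsim_refl.
rewrite !big_cons; case: (simW i) IHr => B eqB freeB homB [C eqC freeC homC].
exists (block_mx B 0 0 C) => [||g Gg]; first by rewrite /= eqB eqC.
  by rewrite /row_free rank_diag_block_mx (eqP freeB) (eqP freeC).
by rewrite !mulmx_block !(mulmx0, mul0mx, addr0, add0r) homB ?homC.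
Qed.

End Similarity.

Lemma mx_rsim_outer (F : fieldType) (gT1 gT2 : finGroupType) n1 n2 n2'
    (rG1 : mx_representation F [set: gT1] n1)
    (rG2 : mx_representation F [set: gT2] n2)
    (rG2' : mx_representation F [set: gT2] n2') :
  mx_rsim rG2 rG2' -> mx_rsim (outer_repr rG1 rG2) (outer_repr rG1 rG2').
Proof.
case=> f def_n; rewrite -{n2'}def_n in rG2' f * => free_f hom_f.
rewrite row_free_unit in free_f; exists (tprod 1%:M f) => // [|[g h] _].
  by apply/row_freeP; exists (tprod 1%:M (invmx f)); rewrite -tprodE mulmx1 mulmxV ?tprod1.
by rewrite /= -!tprodE mulmx1 mul1mx [_ *m f]hom_f ?inE.
Qed.

(** * Generators of induced modules *)

Section InducedGenerators.

Variables (F : fieldType) (gT : finGroupType) (H : {group gT}) (n : nat).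
Variable rH : mx_representation F H n.

Local Notation c := #|rcosets H [set: gT]|.

(* The map m |-> m (x) g from the inducing module to the induced one. *)
Definition ind_coef (g : gT) (i : 'I_c) : 'M[F]_n :=
  let h := (g * (coset_elt i)^-1)%g in if h \in H then rH h else 0.

Definition ind_gen (g : gT) : 'M[F]_(n, \sum_(i < c) n) := \mxrow_i ind_coef g i.

(** [ind_gen g] is concentrated on the block of the coset of [g], so a single term of the product
    survives. *)
Lemma ind_genJ g x : ind_gen g *m ind_repr rH x = ind_gen (g * x)%g.
Proof.
rewrite mul_mxrow_mxblock; apply: eq_mxrow => j.
have [k Hk] := coset_eltP H g.
rewrite (bigD1 k) //= big1 ?addr0 => [|l neq_lk]; last first.
  rewrite /ind_coef; case: ifP => [Hl|_]; last by rewrite mul0mx.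
  by rewrite (coset_elt_inj Hl Hk) eqxx in neq_lk.
rewrite /ind_coef /ind_block Hk.
have -> : (g * x * (coset_elt j)^-1 = g * (coset_elt k)^-1 *
  (coset_elt k * x * (coset_elt j)^-1))%g by rewrite !mulgA mulgKV.
rewrite /= (groupMl _ Hk); case: ifP => H2; last by rewrite mulmx0.
by rewrite (repr_mxM _ Hk H2).
Qed.

(** The balancing relation $m \otimes hg = mh \otimes g$. *)
Lemma ind_genM h g : h \in H -> ind_gen (h * g)%g = rH h *m ind_gen g.
Proof.
move=> Hh; rewrite mul_mxrow; apply: eq_mxrow => i.
rewrite /ind_coef -mulgA /= (groupMl _ Hh); case: ifP => Hg; last by rewrite mulmx0.
by rewrite (repr_mxM _ Hh Hg).
Qed.

Lemma submxrow_ind_gen h i j :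
  h \in H -> submxrow (ind_gen (h * coset_elt i)%g) j = if i == j then rH h else 0.
Proof.
move=> Hh; rewrite mxrowK /ind_coef; case: eqP => [<-|neq_ij]; first by rewrite mulgK Hh.
case: ifP => // Hij; case: neq_ij; apply: coset_elt_inj Hij.
by rewrite mulgK.
Qed.

End InducedGenerators.

(** * Cycle types *)

(** The first $n$ iterates of $y$ list its orbit without repetition, and $r^n$ fixes $y$. *)
Lemma porbit_expg_eq (T : finType) (r : {perm T}) (y : T) i j :
  ((r ^+ i)%g y == (r ^+ j)%g y) = (i == j %[mod #|porbit r y|]).
Proof.
set n := #|_|; have n_gt0 : (0 < n)%N by rewrite lt0n card_porbit_neq0.
have fixE m : ((r ^+ n) ^+ m)%g y = y.
  elim: m => [|m IHm]; first by rewrite expg0 perm1.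
  by rewrite expgSr permM IHm permX iter_porbit.
have modE k : (r ^+ k)%g y = nth y (traject r y n) (k %% n)%N.
  rewrite nth_traject ?ltn_mod // -permX {1}(divn_eq k n) expgD mulnC expgM.
  by rewrite permM fixE.
by rewrite !modE nth_uniq ?size_traject ?ltn_mod ?uniq_traject_porbit.
Qed.

Section CycleType.

Variable b : nat.
Implicit Types p q : 'S_b.

(** This is the conjugate of the partition formed by the cycle lengths. It determines the same
    conjugacy class, and its parts decrease without any sorting. *)
Definition cycle_type_fun p : {ffun 'I_b -> 'I_b.+1} :=
  [ffun j : 'I_b => inord #|[set O in porbits p | (j < #|O|)%N]|].

Lemma cycle_type_funE p j :
  cycle_type_fun p j = #|[set O in porbits p | (j < #|O|)%N]| :> nat.
Proof.
rewrite ffunE inordK // ltnS -[leqRHS]card_ord.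
apply: leq_trans (leq_imset_card (porbit p) _).
by apply/subset_leq_card/subsetP=> O; rewrite inE => /andP[].
Qed.

Lemma sum_card_porbits p : (\sum_(O in porbits p) #|O| = b)%N.
Proof.
rewrite -[RHS]card_ord -[RHS]cardsT; apply/esym/card_partition/and3P; split.
- apply/eqP/setP=> x; rewrite inE; apply/bigcupP.
  by exists (porbit p x); rewrite ?imset_f ?porbit_id.
- apply/trivIsetP=> _ _ /imsetP[x _ ->] /imsetP[y _ ->]; apply: contraR.
  rewrite -setI_eq0 => /set0Pn[z /setIP[]].
  by rewrite -!eq_porbit_mem => /eqP<- /eqP<-.
- by apply/imsetP=> -[x _ /setP/(_ x)]; rewrite inE porbit_id.
Qed.

Lemma cycle_type_part p : is_part (cycle_type_fun p).
Proof.
apply/andP; split.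
  apply/forallP=> i; apply/forallP=> j; apply/implyP=> le_ij.
  rewrite !cycle_type_funE subset_leq_card //; apply/subsetP=> O.
  by rewrite !inE => /andP[->]; apply: leq_ltn_trans.
under eq_bigr => j _ do rewrite cycle_type_funE -sum1dep_card big_mkcondr /=.
rewrite exchange_big /= -[X in _ == X](sum_card_porbits p); apply/eqP/eq_bigr => O _.
rewrite -big_mkcond /=.
have le_Ob : (#|O| <= b)%N by rewrite -[leqRHS]card_ord max_card.
by rewrite (big_ord_narrow_cond (P := xpredT) (F := fun=> 1%N) le_Ob)
     sum1_card card_ord.
Qed.

Definition cycle_type p : intpart b :=
  exist (fun l => is_part l) _ (cycle_type_part p).

Lemma cycle_type_card p q k : cycle_type p = cycle_type q ->
  #|[set O in porbits p | #|O| == k]| = #|[set O in porbits q | #|O| == k]|.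
Proof.
(* An index [j] of at least [b] names no part; the count is 0 there because no orbit has more than
   [b] letters. *)
have gtE r j : #|[set O in porbits r | (j < #|O|)%N]| =
    if insub j is Some i then nat_of_ord (val (cycle_type r) i) else 0%N.
  case: insubP => [i _ <-|]; first by rewrite /= cycle_type_funE.
  rewrite -leqNgt => le_bj; apply: eq_card0 => O; rewrite !inE.
  by rewrite ltnNge (leq_trans _ le_bj) ?andbF // -[leqRHS]card_ord max_card.
have porbit0 r O : O \in porbits r -> (0 < #|O|)%N.
  by case/imsetP=> x _ ->; rewrite lt0n card_porbit_neq0.
case: k => [_|k eq_pq].
  by rewrite !eq_card0 // => O; rewrite !inE; case: (boolP (O \in _)) => // /porbit0;
     case: #|O|.
have eqE r : #|[set O in porbits r | #|O| == k.+1]| =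
    (#|[set O in porbits r | (k < #|O|)%N]| - #|[set O in porbits r | (k.+1 < #|O|)%N]|)%N.
  have sub_gt : [set O in porbits r | (k.+1 < #|O|)%N] \subset
      [set O in porbits r | (k < #|O|)%N].
    by apply/subsetP=> O; rewrite !inE => /andP[->]; apply: ltnW.
  rewrite -(cardsDS sub_gt); apply: eq_card => O; rewrite !inE.
  by case: (O \in porbits r); rewrite ?andbF //= -leqNgt eqn_leq.
by rewrite !eqE !gtE eq_pq.
Qed.

(* Conjugation is built orbit by orbit: p ^+ i applied to a base point of an
   orbit goes to q ^+ i applied to a base point of the matching orbit. *)
Lemma cycle_type_conj p q : cycle_type p = cycle_type q ->
  exists f : 'S_b, forall x, f (p x) = q (f x).
Proof.
move=> eq_pq.
pose orbs (r : 'S_b) k := enum [set O in porbits r | #|O| == k].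
(* The $i$-th orbit of [p] of a given size is matched with the $i$-th orbit of [q] of that size; the
   two lists are equally long by [cycle_type_card]. *)
pose match_ (O : {set 'I_b}) := nth set0 (orbs q #|O|) (index O (orbs p #|O|)).
have orbsP r O : O \in porbits r -> O \in orbs r #|O|.
  by rewrite mem_enum inE => ->; rewrite eqxx.
have size_orbs k : size (orbs p k) = size (orbs q k).
  by rewrite -!cardE; apply: cycle_type_card.
have matchP O : O \in porbits p -> match_ O \in orbs q #|O|.
  by move/orbsP=> pO; rewrite mem_nth // -size_orbs index_mem.
have match_q O : O \in porbits p -> match_ O \in porbits q /\ #|match_ O| = #|O|.
  by move/matchP; rewrite mem_enum inE => /andP[-> /eqP].
have match_inj : {in porbits p &, injective match_}.
  move=> O O' pO pO' eqO.
  have eq_card : #|O| = #|O'|.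
    by rewrite -(match_q O pO).2 eqO (match_q O' pO').2.
  have p_O : O \in orbs p #|O'| by rewrite -eq_card orbsP.
  have p_O' := orbsP _ _ pO'.
  move/eqP: eqO; rewrite /match_ eq_card nth_uniq ?enum_uniq -?size_orbs ?index_mem //.
  by move/eqP/(congr1 (nth set0 (orbs p #|O'|))); rewrite !nth_index.
pose base (O : {set 'I_b}) (x : 'I_b) := odflt x [pick y in O].
have baseP (O : {set 'I_b}) x : (0 < #|O|)%N -> base O x \in O.
  by rewrite /base; case: pickP => // O0; rewrite eq_card0.
have base_indep (O : {set 'I_b}) x x' : (0 < #|O|)%N -> base O x = base O x'.
  by rewrite /base; case: pickP => // O0; rewrite eq_card0.
have porbit_gt0 x : (0 < #|porbit p x|)%N by rewrite lt0n card_porbit_neq0.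
have pO x : porbit p x \in porbits p by apply: imset_f.
pose pb x := base (porbit p x) x; pose qb x := base (match_ (porbit p x)) x.
have porbit_pb x : porbit p (pb x) = porbit p x.
  by apply/eqP; rewrite eq_porbit_mem baseP.
have qbP x : porbit q (qb x) = match_ (porbit p x).
  have [/imsetP[y _ Dy] eq_card] := match_q _ (pO x).
  rewrite Dy; apply/eqP; rewrite eq_porbit_mem -Dy baseP //.
  by rewrite eq_card.
have idxP x : exists i, x == (p ^+ i)%g (pb x).
  have /porbitP[i /eqP Dx] : x \in porbit p (pb x) by rewrite porbit_pb porbit_id.
  by exists i.
pose f x := (q ^+ (xchoose (idxP x)))%g (qb x).
(* Any exponent leading from the base point to [x] may be used: matched orbits have equal sizes,
   hence equal periods. *)
have fE x i : x = (p ^+ i)%g (pb x) -> f x = (q ^+ i)%g (qb x).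
  move=> Dx; apply/eqP; rewrite porbit_expg_eq qbP (match_q _ (pO x)).2.
  rewrite -porbit_pb -porbit_expg_eq -Dx eq_sym; exact: (xchooseP (idxP x)).
have porbit_f x : porbit q (f x) = match_ (porbit p x) by rewrite porbit_perm qbP.
have f_inj : injective f.
  move=> x y eq_f; have eqO: porbit p x = porbit p y.
    by apply: match_inj; rewrite // -!porbit_f eq_f.
  have eq_pb : pb x = pb y by rewrite /pb eqO; apply: base_indep.
  have eq_qb : qb x = qb y.
    by rewrite /qb eqO; apply: base_indep; rewrite (match_q _ (pO y)).2.
  have [i Dx] := idxP x; have [j Dy] := idxP y; move: eq_f.
  rewrite (fE x i (eqP Dx)) (fE y j (eqP Dy)) eq_qb => /eqP.
  rewrite porbit_expg_eq qbP (match_q _ (pO y)).2 -porbit_pb -porbit_expg_eq.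
  by rewrite -{1}eq_pb -(eqP Dx) -(eqP Dy) => /eqP.
exists (perm f_inj) => x; rewrite !permE.
have eqO : porbit p (p x) = porbit p x
  by have /eqP := porbit_perm p 1 x; rewrite expg1 => /eqP.
have eq_pb : pb (p x) = pb x by rewrite /pb eqO; apply: base_indep.
have eq_qb : qb (p x) = qb x.
  by rewrite /qb eqO; apply: base_indep; rewrite (match_q _ (pO x)).2.
have [i /eqP Dx] := idxP x; rewrite (fE x i Dx) -permM -expgSr -eq_qb.
by apply: fE; rewrite eq_pb expgSr permM -Dx.
Qed.

(** Combined with the injection from partitions to irreducible modules, this bound makes that
    injection a bijection. *)
Lemma card_classes_perm : (#|classes [set: 'S_b]| <= #|{: intpart b}|)%N.
Proof.
pose ct (C : {set 'S_b}) := cycle_type (repr C).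
have ct_inj : {in classes [set: 'S_b] &, injective ct}.
  move=> C D /repr_classesP[_ defC] /repr_classesP[_ defD] /cycle_type_conj[f fE].
  have conjD : repr D = (repr C ^ f)%g.
    by apply/permP=> x; rewrite conjgE !permM fE permKV.
  by rewrite defC defD conjD classGidl ?inE.
rewrite -(card_in_imset ct_inj); exact: max_card.
Qed.

End CycleType.

(** * Specht modules *)

Section Fillings.

Variable b : nat.
Implicit Types (l m : intpart b) (tau sigma : 'I_b -> 'I_b * 'I_b).

(* A tableau is recorded by the function sending a letter to its cell. *)
Definition filling l tau :=
  injective tau /\ forall x, ((tau x).2 < val l (tau x).1)%N.

(** The hypothesis of the basic combinatorial lemma on pairs of tableaux. *)
Definition transverse tau sigma := forall x y,
  (tau x).2 = (tau y).2 -> (sigma x).1 = (sigma y).1 -> x = y.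

Definition swap_filling tau x := ((tau x).2, (tau x).1).

Lemma intpart_homo l (i j : 'I_b) : (i <= j)%N -> (val l j <= val l i)%N.
Proof. by have /andP[/'forall_'forall_implyP hl _] := valP l; apply: hl. Qed.

Lemma intpart_sum l : (\sum_i val l i = b)%N.
Proof. by have /andP[_ /eqP] := valP l. Qed.

Lemma card_cells l (P : pred 'I_b) :
  #|[set c : 'I_b * 'I_b | P c.1 & (c.2 < val l c.1)%N]| = (\sum_(i | P i) val l i)%N.
Proof.
rewrite -sum1dep_card.
rewrite -(pair_big_dep P (fun i (j : 'I_b) => j < val l i)%N (fun _ _ => 1%N)) /=.
apply: eq_bigr => i _; have le_lb : (val l i <= b)%N by rewrite -ltnS ltn_ord.
by rewrite (big_ord_narrow_cond (P := xpredT) (F := fun=> 1%N) le_lb)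
     sum1_card card_ord.
Qed.

(** An injection of the $b$ letters into the $b$ cells of the diagram is onto. *)
Lemma filling_onto l tau (i j : 'I_b) :
  filling l tau -> (j < val l i)%N -> exists x, tau x = (i, j).
Proof.
case=> tau_inj tau_l lt_jl.
have: (i, j) \in tau @: setT.
  suff -> : tau @: setT = [set c : 'I_b * 'I_b | true & (c.2 < val l c.1)%N].
    by rewrite inE.
  apply/eqP; rewrite eqEcard card_imset // cardsT card_ord.
  rewrite (card_cells l xpredT) intpart_sum leqnn andbT.
  by apply/subsetP=> _ /imsetP[x _ ->]; rewrite inE /= tau_l.
by case/imsetP=> x _ ->; exists x.
Qed.

Lemma card_filling_rows l tau (P : pred 'I_b) :
  filling l tau -> #|[set x | P (tau x).1]| = (\sum_(i | P i) val l i)%N.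
Proof.
move=> fill_tau; rewrite -card_cells -(card_imset _ fill_tau.1).
apply: eq_card => -[i j]; rewrite inE /=; apply/imsetP/andP.
  by case=> x; rewrite inE => Px Dx; have := fill_tau.2 x; rewrite -Dx in Px *; split.
by case=> Pi /(filling_onto fill_tau)[x Dx]; exists x; rewrite ?inE Dx.
Qed.

(** If column [j] of [tau] stops before row [r], the right side counts the whole column. Otherwise
    the column has a cell in each of the first [r] rows, while by transversality its letters lie in
    distinct rows of [sigma]. *)
Lemma transverse_col_card l tau sigma j r : filling l tau -> transverse tau sigma ->
  (#|[set x | (tau x).2 == j & (sigma x).1 < r]| <=
   #|[set x | (tau x).2 == j & (tau x).1 < r]|)%N.
Proof.
move=> fill_tau tr.
have [/existsP[x /andP[/eqP col_x le_rx]]|] :=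
  boolP [exists x, ((tau x).2 == j) && (r <= (tau x).1)%N]; last first.
  move/existsPn=> lt_r; apply/subset_leq_card/subsetP=> x.
  by rewrite !inE => /andP[col_x _]; have := lt_r x; rewrite col_x -ltnNge.
pose rows (sg : 'I_b -> 'I_b * 'I_b) :=
  (fun x => (sg x).1) @: [set x | (tau x).2 == j & ((sg x).1 < r)%N].
have <- : #|rows sigma| = #|[set x | (tau x).2 == j & ((sigma x).1 < r)%N]|.
  apply: card_in_imset => y z; rewrite !inE => /andP[/eqP cy _] /andP[/eqP cz _].
  by apply: tr; rewrite cy cz.
apply: leq_trans (leq_imset_card (fun x => (tau x).1) _).
apply/subset_leq_card/subsetP=> _ /imsetP[y /[!inE] /andP[_ lt_yr] ->].
set i := (sigma y).1 in lt_yr *.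
have [z Dz] : exists z, tau z = (i, j).
  apply: (filling_onto fill_tau); rewrite -col_x.
  by apply: leq_trans (fill_tau.2 x) (intpart_homo _ _); apply: ltnW (leq_trans lt_yr _).
by apply/imsetP; exists z; rewrite ?inE Dz ?eqxx.
Qed.

(** Sum [transverse_col_card] over all columns of [tau]. *)
Lemma transverse_dominates l m tau sigma r :
  filling l tau -> filling m sigma -> transverse tau sigma ->
  (\sum_(i : 'I_b | i < r) val m i <= \sum_(i : 'I_b | i < r) val l i)%N.
Proof.
move=> fill_tau fill_sigma tr.
rewrite -(card_filling_rows (fun i : 'I_b => i < r)%N fill_tau).
rewrite -(card_filling_rows (fun i : 'I_b => i < r)%N fill_sigma).
rewrite -!sum1dep_card (partition_big (fun x => (tau x).2) xpredT) //=.
rewrite [leqRHS](partition_big (fun x => (tau x).2) xpredT) //=.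
apply: leq_sum => j _; rewrite !sum1dep_card.
have := transverse_col_card j r fill_tau tr.
by congr (_ <= _)%N; apply: eq_card => x; rewrite !inE andbC.
Qed.

Lemma dominance_antisym l m :
  (forall r, (\sum_(i : 'I_b | i < r) val m i <= \sum_(i : 'I_b | i < r) val l i)%N) ->
  (forall r, (\sum_(i : 'I_b | i < r) val l i <= \sum_(i : 'I_b | i < r) val m i)%N) ->
  l = m.
Proof.
move=> le_ml le_lm; apply/val_inj/ffunP=> i; apply/val_inj/eqP => /=.
have eq_sum r : (\sum_(k : 'I_b | k < r) val m k = \sum_(k : 'I_b | k < r) val l k)%N.
  by apply/eqP; rewrite eqn_leq le_ml le_lm.
have recr (F : 'I_b -> nat) :
    (\sum_(k : 'I_b | k < i.+1) F k = F i + \sum_(k : 'I_b | k < i) F k)%N.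
  rewrite (bigD1 i) //=; congr (_ + _)%N; apply: eq_bigl => k.
  by rewrite ltnS -val_eqE [RHS]ltn_neqAle andbC.
by have := eq_sum i.+1; rewrite !recr eq_sum => /addIn ->.
Qed.

(** Summed over the columns, both sides count the letters in the first [r] rows of the same shape,
    so each inequality of [transverse_col_card] is an equality. *)
Lemma transverse_tight l tau sigma r j :
  filling l tau -> filling l sigma -> transverse tau sigma ->
  #|[set x | (tau x).2 == j & (sigma x).1 < r]|%N =
  #|[set x | (tau x).2 == j & (tau x).1 < r]|%N.
Proof.
move=> fill_tau fill_sigma tr.
have eq_sum : (\sum_j #|[set x | (tau x).2 == j & (sigma x).1 < r]| ==
               \sum_j #|[set x | (tau x).2 == j & (tau x).1 < r]|)%N.
  have sumE (P : pred 'I_b) :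
      (\sum_j #|[set x | (tau x).2 == j & P x]| = #|[set x | P x]|)%N.
    rewrite -[RHS]sum1dep_card [RHS](partition_big (fun x => (tau x).2) xpredT) //=.
    by apply: eq_bigr => k _; rewrite sum1dep_card; apply: eq_card => x; rewrite !inE andbC.
  rewrite !sumE (card_filling_rows (fun i : 'I_b => i < r)%N fill_tau).
  by rewrite (card_filling_rows (fun i : 'I_b => i < r)%N fill_sigma).
have := leqif_sum (fun k (_ : xpredT k) =>
  leqif_eq (transverse_col_card k r fill_tau tr)).
by case=> _; rewrite eq_sum => /esym/forall_inP/(_ j isT)/eqP.
Qed.

(* Counting the entries of each column of tau that sigma puts in its first rows
   leaves no slack when both shapes agree. *)
Lemma transverse_col_perm l tau sigma :
  filling l tau -> filling l sigma -> transverse tau sigma ->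
  exists p : 'S_b, forall x, tau (p x) = ((sigma x).1, (tau x).2).
Proof.
move=> fill_tau fill_sigma tr.
(* Otherwise this column of [tau] ends above the row of [sigma x]. Then all its letters are above
   that row in [tau], but [x] is not in [sigma], against [transverse_tight]. *)
have in_l x : ((tau x).2 < val l (sigma x).1)%N.
  rewrite ltnNge; apply/negP => le_l.
  have := transverse_tight (sigma x).1 (tau x).2 fill_tau fill_sigma tr.
  apply/eqP; rewrite neq_ltn; apply/orP; left.
  apply: proper_card; apply/properP; split.
    apply/subsetP=> y; rewrite !inE => /andP[/eqP col_y _]; rewrite col_y eqxx ltnNge.
    apply/negP => le_xy; have := fill_tau.2 y; rewrite col_y ltnNge.
    by rewrite (leq_trans _ le_l) // intpart_homo.
  exists x; rewrite !inE eqxx ?ltnn //= ltnNge; apply/negP => le_xy.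
  by have := fill_tau.2 x; rewrite ltnNge (leq_trans _ le_l) // intpart_homo.
have exP x : exists y, tau y == ((sigma x).1, (tau x).2).
  by have [y Dy] := filling_onto fill_tau (in_l x); exists y; apply/eqP.
pose f x := xchoose (exP x); have fE x : tau (f x) = ((sigma x).1, (tau x).2).
  exact/eqP/(xchooseP (exP x)).
have f_inj : injective f.
  by move=> x y /(congr1 tau); rewrite !fE => -[]; move=> e1 e2; apply: tr.
by exists (perm f_inj) => x; rewrite permE.
Qed.

(** Parts decrease, so once [l j <= i] every row longer than [i] precedes [j], and there are at most
    [j] such rows. *)
Lemma swap_filling_conj l tau : filling (conj_part l) tau -> filling l (swap_filling tau).
Proof.
case=> tau_inj tau_l; split=> [x y [e1 e2]|x /=].
  by apply: tau_inj; apply: injective_projections.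
have := tau_l x; rewrite /= conj_funE; case: (tau x) => i j /=.
apply: contraLR; rewrite -!leqNgt => le_l.
apply: (@leq_trans #|[set k : 'I_b | k < j]|%N).
  apply/subset_leq_card/subsetP=> k; rewrite !inE ltnNge => lt_i.
  rewrite ltnNge; apply: contra lt_i => le_jk.
  exact: leq_trans (intpart_homo _ le_jk) le_l.
rewrite -sum1dep_card (big_ord_narrow_cond (P := xpredT) (F := fun=> 1%N)
  (ltnW (ltn_ord j))).
by rewrite sum1_card card_ord.
Qed.

End Fillings.

(** * Row and column symmetrizers, polytabloids *)

Section Symmetrization.

Variables (F : fieldType) (b : nat).
Implicit Types (l m : intpart b) (tau sigma : 'I_b -> 'I_b * 'I_b).
Implicit Types p q g : 'S_b.

Definition row_tabloid tau : tabloid b 'I_b := [ffun i => [set x | (tau x).1 == i]].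

(** Row stabilizers are obtained from the same definition applied to [swap_filling tau], abbreviated
    [R tau]. *)
Definition filling_col_stab tau : {set 'S_b} :=
  [set p : 'S_b | [forall x, (tau (p x)).2 == (tau x).2]].

Local Notation C := filling_col_stab.
Local Notation R tau := (filling_col_stab (swap_filling tau)).
Local Notation rho := (tabloid_repr F b ('P : {action 'S_b &-> 'I_b})).
Local Notation bv tau := (basis_vec F (row_tabloid tau)).

Lemma filling_col_stabP tau p :
  reflect (forall x, (tau (p x)).2 = (tau x).2) (p \in C tau).
Proof. by rewrite inE; apply: (iffP 'forall_eqP). Qed.

Lemma filling_col_stab_group tau : group_set (C tau).
Proof.
apply/group_setP; split; first by apply/filling_col_stabP=> x; rewrite perm1.
move=> p q /filling_col_stabP hp /filling_col_stabP hq.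
by apply/filling_col_stabP=> x; rewrite permM hq hp.
Qed.

Canonical filling_col_stab_groupType tau := Group (filling_col_stab_group tau).

Lemma tperm_col_stab tau x y : (tau x).2 = (tau y).2 -> tperm x y \in C tau.
Proof. by move=> exy; apply/filling_col_stabP=> z; case: tpermP => [->|->|]. Qed.

Lemma row_tabloid_act tau g :
  tabloid_action b ('P : {action 'S_b &-> 'I_b}) (row_tabloid tau) g =
  row_tabloid (fun x => tau ((g^-1)%g x)).
Proof.
apply/ffunP=> i; rewrite !ffunE /= setactE; apply/setP=> x; rewrite inE.
apply/imsetP/idP=> [[y]|row_x]; first by rewrite inE => row_y ->; rewrite /aperm permK.
by exists ((g^-1)%g x); [rewrite inE | rewrite /= /aperm permKV].
Qed.

Lemma row_tabloidJ tau g : bv tau *m rho g = bv (fun x => tau ((g^-1)%g x)).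
Proof. by rewrite basis_vecJ row_tabloid_act. Qed.

Section Symmetrizers.

Variables (n : nat) (V : mx_representation F [set: 'S_b] n).

Definition col_antisym tau := \sum_(p in C tau) (-1) ^+ p *: V p.
Definition row_sym tau := \sum_(p in R tau) V p.

Lemma col_antisymMl tau q :
  q \in C tau -> V q *m col_antisym tau = (-1) ^+ q *: col_antisym tau.
Proof.
move=> Cq; rewrite mulmx_sumr scaler_sumr.
rewrite [RHS](reindex_inj (mulgI q)) /=; apply: eq_big => [p|p Cp].
  by rewrite groupMl.
by rewrite -scalemxAr scalerA odd_permM signr_addb mulrA -signr_addb addbb mul1r
  repr_mxM ?inE.
Qed.

Lemma col_antisymMr tau q :
  q \in C tau -> col_antisym tau *m V q = (-1) ^+ q *: col_antisym tau.
Proof.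
move=> Cq; rewrite mulmx_suml scaler_sumr.
rewrite [RHS](reindex_inj (mulIg q)) /=; apply: eq_big => [p|p Cp].
  by rewrite groupMr.
rewrite -scalemxAl scalerA odd_permM signr_addb mulrCA -signr_addb addbb mulr1.
by rewrite repr_mxM ?inE.
Qed.

Lemma row_symMl tau q : q \in R tau -> V q *m row_sym tau = row_sym tau.
Proof.
move=> Rq; rewrite mulmx_sumr [RHS](reindex_inj (mulgI q)) /=.
by apply: eq_big => [p|p Rp]; rewrite ?groupMl // repr_mxM ?inE.
Qed.

(** In characteristic 0 this prevents a nonzero antisymmetrizer from being nilpotent. *)
Lemma col_antisym_idem tau :
  col_antisym tau *m col_antisym tau = #|C tau|%:R *: col_antisym tau.
Proof.
rewrite {1}/col_antisym mulmx_suml scaler_nat -sumr_const; apply: eq_bigr => p Cp.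
by rewrite -scalemxAl col_antisymMl // scalerA -signr_addb addbb scale1r.
Qed.

Lemma col_antisym_conj tau g :
  V g *m col_antisym (fun x => tau ((g^-1)%g x)) = col_antisym tau *m V g.
Proof.
rewrite mulmx_sumr mulmx_suml [LHS](reindex_inj (conjg_inj g)) /=.
apply: eq_big => [p|p _].
  apply/filling_col_stabP/filling_col_stabP=> h x.
    by have := h (g x); rewrite conjgE !permM !permK.
  by rewrite conjgE !permM permK h.
rewrite -scalemxAl -scalemxAr odd_permJ -!repr_mxM ?inE //.
by rewrite conjgE mulKVg.
Qed.

End Symmetrizers.

Definition filling_polytabloid tau := bv tau *m col_antisym rho tau.

Local Notation e := filling_polytabloid.

Lemma filling_polytabloidJ tau g : e tau *m rho g = e (fun x => tau ((g^-1)%g x)).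
Proof. by rewrite /e -mulmxA -col_antisym_conj mulmxA row_tabloidJ. Qed.

Lemma filling_polytabloidE tau :
  e tau = \sum_(p in C tau) (-1) ^+ p *: bv (fun x => tau ((p^-1)%g x)).
Proof.
rewrite /e mulmx_sumr; apply: eq_bigr => p _.
by rewrite -scalemxAr row_tabloidJ.
Qed.

End Symmetrization.

Section Polytabloids.

Variables (F : fieldType) (b : nat).
Hypothesis F0 : [pchar F] =i pred0.
Implicit Types (l m : intpart b) (tau sigma : 'I_b -> 'I_b * 'I_b).
Implicit Types p q g : 'S_b.

Local Notation C := filling_col_stab.
Local Notation R tau := (filling_col_stab (swap_filling tau)).
Local Notation rho := (tabloid_repr F b ('P : {action 'S_b &-> 'I_b})).
Local Notation bv tau := (basis_vec F (row_tabloid tau)).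
Local Notation e := (filling_polytabloid F).

Lemma pchar0_natf_neq0 k : (0 < k)%N -> k%:R != 0 :> F.
Proof. by move/pcharf0P: F0 => ->; rewrite lt0n. Qed.

Lemma eq_row_tabloid tau sigma :
  (row_tabloid tau == row_tabloid sigma) = [forall x, (tau x).1 == (sigma x).1].
Proof.
apply/eqP/'forall_eqP=> [eq_tab x|eq_row]; last first.
  by apply/ffunP=> i; rewrite !ffunE; apply/setP=> x; rewrite !inE eq_row.
move/ffunP/(_ (tau x).1)/setP/(_ x): eq_tab.
by rewrite !ffunE !inE eqxx => /esym/eqP.
Qed.

Lemma eq_opp_eq0 n (v : 'rV[F]_n) : v = - v -> v = 0.
Proof.
move=> Dv; apply/eqP; have /eqP := congr1 (+%R v) Dv.
by rewrite subrr -mulr2n -scaler_nat scaler_eq0 (negPf (pchar0_natf_neq0 _)).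
Qed.

(** The transposition of [x] and [y] fixes the tabloid of [sigma] and changes the sign of the
    antisymmetrizer. *)
Lemma row_tabloid_col_antisym0 tau sigma x y : x != y ->
  (tau x).2 = (tau y).2 -> (sigma x).1 = (sigma y).1 ->
  bv sigma *m col_antisym rho tau = 0.
Proof.
move=> neq_xy col_xy row_xy; apply: eq_opp_eq0.
have Cxy := tperm_col_stab col_xy; rewrite -mulmxN.
have := col_antisymMl rho Cxy; rewrite odd_tperm neq_xy scaleN1r => <-.
rewrite mulmxA row_tabloidJ; congr (_ *m _); congr basis_vec.
apply/esym/eqP; rewrite eq_row_tabloid; apply/'forall_eqP=> z.
by rewrite tpermV; case: tpermP => [->|->|].
Qed.

(** The same transposition argument with the roles exchanged: it negates the polytabloid and fixes
    the symmetrizer. *)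
Lemma filling_polytabloid_row_sym0 tau sigma x y : x != y ->
  (tau x).1 = (tau y).1 -> (sigma x).2 = (sigma y).2 ->
  e sigma *m row_sym rho tau = 0.
Proof.
move=> neq_xy row_xy col_xy; apply: eq_opp_eq0.
have Cxy := tperm_col_stab col_xy.
have Rxy : tperm x y \in R tau by apply: tperm_col_stab.
rewrite -{2}(row_symMl rho Rxy) mulmxA /e -(mulmxA _ _ (rho _)).
by rewrite (col_antisymMr rho Cxy) odd_tperm neq_xy scaleN1r mulmxN mulNmx opprK.
Qed.

Lemma transverseP tau sigma : transverse tau sigma \/
  exists x y, [/\ x != y, (tau x).2 = (tau y).2 & (sigma x).1 = (sigma y).1].
Proof.
case: (boolP [exists x, exists y,
  [&& x != y, (tau x).2 == (tau y).2 & (sigma x).1 == (sigma y).1]]).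
  by case/existsP=> x /existsP[y /and3P[? /eqP ? /eqP ?]]; right; exists x, y.
move/existsPn=> tr; left=> x y col_xy row_xy; apply/eqP/negPn/negP=> neq_xy.
by have /existsPn/(_ y)/negP[] := tr x; rewrite neq_xy col_xy row_xy !eqxx.
Qed.

(** Either a transposition kills the tabloid, or [sigma] has the tabloid of a column permutation of
    [tau], which yields a signed [e tau]. Hence the antisymmetrizer has rank at most one on tabloids
    of shape [l]. *)
Lemma row_tabloid_col_antisym l tau sigma :
  filling l tau -> filling l sigma ->
  exists a, bv sigma *m col_antisym rho tau = a *: e tau.
Proof.
move=> fill_tau fill_sigma.
have [tr|[x [y [neq_xy col_xy row_xy]]]] := transverseP tau sigma; last first.
  by exists 0; rewrite scale0r (row_tabloid_col_antisym0 neq_xy).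
have [p pE] := transverse_col_perm fill_tau fill_sigma tr.
have Cp : p \in C tau by apply/filling_col_stabP=> x; rewrite pE.
exists ((-1) ^+ p).
have -> : bv sigma = bv tau *m rho (p^-1)%g.
  rewrite row_tabloidJ invgK; congr basis_vec; apply/eqP.
  by rewrite eq_row_tabloid; apply/'forall_eqP=> x; rewrite pE.
by rewrite -mulmxA col_antisymMl ?groupV // odd_permV -scalemxAr.
Qed.

Lemma row_tabloid_coef tau sigma :
  bv sigma 0 (enum_rank (row_tabloid tau)) = [forall x, (tau x).1 == (sigma x).1]%:R.
Proof. by rewrite mxE eqxx (inj_eq enum_rank_inj) eq_row_tabloid. Qed.

(** Row and column stabilizers meet trivially, so only the term [p = 1] of the polytabloid
    contributes, once for each row permutation. *)
Lemma filling_polytabloid_row_sym_coef tau : injective tau ->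
  (e tau *m row_sym rho tau) 0 (enum_rank (row_tabloid tau)) = #|R tau|%:R.
Proof.
move=> tau_inj.
rewrite filling_polytabloidE mulmx_suml summxE (bigD1 1%g) ?group1 //=.
rewrite [X in _ + X]big1 ?addr0 => [|p /andP[Cp neq_p1]].
  rewrite odd_perm1 scale1r mulmx_sumr summxE -sumr_const; apply: eq_bigr => q Rq.
  rewrite row_tabloidJ row_tabloid_coef invg1; case: forallP => // -[] x.
  by rewrite perm1 eq_sym; apply/eqP/(filling_col_stabP _ _ (groupVr Rq)).
rewrite -scalemxAl mxE mulmx_sumr summxE big1 ?mulr0 // => q Rq.
rewrite row_tabloidJ row_tabloid_coef; case: forallP => // eq_row.
case/eqP: neq_p1; apply/permP=> x; rewrite perm1; apply: tau_inj.
apply: injective_projections; last exact: (filling_col_stabP _ _ Cp).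
have /eqP := eq_row (q (p x)); rewrite !permK => <-.
exact/esym/(filling_col_stabP _ _ Rq).
Qed.

Lemma filling_polytabloid_neq0 tau : injective tau -> e tau != 0.
Proof.
move=> tau_inj; apply/eqP=> e0; have := filling_polytabloid_row_sym_coef tau_inj.
rewrite e0 mul0mx mxE => /esym/eqP; apply/negP/pchar0_natf_neq0.
exact: cardG_gt0.
Qed.

End Polytabloids.

(** * Specht modules are simple and pairwise non-isomorphic *)

Section SpechtIrreducibility.

Variables (F : fieldType) (b : nat).
Hypothesis F0 : [pchar F] =i pred0.
Implicit Types (l m : intpart b) (tau sigma : 'I_b -> 'I_b * 'I_b).
Implicit Types p q g : 'S_b.

Local Notation C := filling_col_stab.
Local Notation R tau := (filling_col_stab (swap_filling tau)).
Local Notation rho := (tabloid_repr F b ('P : {action 'S_b &-> 'I_b})).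
Local Notation bv tau := (basis_vec F (row_tabloid tau)).
Local Notation e := (filling_polytabloid F).

Lemma card_cell l : #|{: cell l}| = b.
Proof.
rewrite card_sig -[RHS](intpart_sum l) -(card_cells l xpredT) -[RHS]cardsE.
by rewrite !cardsE; apply: eq_card => c; rewrite !inE.
Qed.

Lemma tableau_exists l : exists t : {ffun cell l -> 'I_b}, is_tableau t.
Proof.
exists [ffun c => cast_ord (card_cell l) (enum_rank c)]; apply/andP; split.
  apply/injectiveP=> c d; rewrite !ffunE => /cast_ord_inj; exact: enum_rank_inj.
apply/forallP=> k; apply/existsP; exists (enum_val (cast_ord (esym (card_cell l)) k)).
by rewrite ffunE enum_valK cast_ordKV.
Qed.

(** Passes from tableaux, which send cells to letters, to fillings, which are their inverses. *)
Lemma tableau_filling l (t : {ffun cell l -> 'I_b}) :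
  is_tableau t -> exists tau, filling l tau /\ forall c, tau (t c) = val c.
Proof.
case/andP=> /injectiveP t_inj /'forall_existsP ex.
pose tinv x := xchoose (ex x); have tinvK x : t (tinv x) = x.
  exact/eqP/(xchooseP (ex x)).
exists (val \o tinv); split; last by move=> c /=; congr val; apply: t_inj; rewrite tinvK.
split=> [x y /val_inj eq_xy|x /=]; first by rewrite -(tinvK x) eq_xy tinvK.
exact: (valP (tinv x)).
Qed.

Lemma polytabloid_filling l (t : {ffun cell l -> 'I_b}) tau :
  is_tableau t -> (forall c, tau (t c) = val c) ->
  polytabloid F t (finfun id) = e tau.
Proof.
case/andP=> /injectiveP t_inj /'forall_existsP ex tauE.
have colE (j : 'I_b) : [set t c | c : cell l & (val c).2 == j] = [set x | (tau x).2 == j].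
  apply/setP=> x; rewrite inE; apply/imsetP/idP=> [[c]|].
    by rewrite inE => col_c ->; rewrite tauE.
  by have [c /eqP <-] := ex x; rewrite tauE => col_c; exists c; rewrite ?inE.
rewrite filling_polytabloidE; apply: eq_big => [p|p _].
  rewrite inE; apply/forallP/filling_col_stabP=> [h x|h j].
    have /eqP/setP/(_ (p x)) := h (tau x).2; rewrite !colE !inE => hx.
    by apply/eqP; rewrite -hx; apply/imset_f; rewrite inE.
  rewrite !colE eqEcard card_imset ?leqnn ?andbT; last exact: perm_inj.
  by apply/subsetP=> _ /imsetP[x /[!inE] /eqP <- ->]; rewrite h.
congr (_ *: basis_vec _ _); apply/ffunP=> i; rewrite !ffunE; apply/setP=> x; rewrite inE.
apply/imsetP/idP=> [[c]|row_x].
  by rewrite inE => row_c ->; rewrite ffunE permK tauE.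
have [c /eqP Dx] := ex ((p^-1)%g x); exists c; last by rewrite ffunE Dx permKV.
by rewrite inE -tauE Dx.
Qed.

Lemma filling_conj l tau sigma :
  filling l tau -> filling l sigma -> exists g, sigma =1 (fun x => tau ((g^-1)%g x)).
Proof.
move=> fill_tau fill_sigma.
have ex x : exists y, tau y == sigma x.
  case Dc : (sigma x) => [i j]; have lt_j : (j < val l i)%N.
    by have := fill_sigma.2 x; rewrite Dc.
  by have [y Dy] := filling_onto fill_tau lt_j; exists y; rewrite Dy.
pose f x := xchoose (ex x); have fE x : tau (f x) = sigma x by exact/eqP/(xchooseP (ex x)).
have f_inj : injective f.
  by move=> x y /(congr1 tau); rewrite !fE; apply: fill_sigma.1.
by exists (perm f_inj)^-1%g => x; rewrite invgK permE fE.
Qed.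

Lemma eq_filling_polytabloid tau sigma : tau =1 sigma -> e tau = e sigma.
Proof.
move=> eq_ts; rewrite !filling_polytabloidE; apply: eq_big => [p|p _].
  by apply/filling_col_stabP/filling_col_stabP=> h x; have := h x; rewrite !eq_ts.
congr (_ *: basis_vec _ _); apply/eqP.
by rewrite eq_row_tabloid; apply/forallP=> x; rewrite eq_ts.
Qed.

Lemma filling_exists l : exists tau, filling l tau.
Proof.
have [t /tableau_filling[tau [fill_tau _]]] := tableau_exists l.
by exists tau.
Qed.

(** The symmetric group is transitive on fillings of shape [l], so one polytabloid generates. *)
Lemma specht_spaceE l tau : filling l tau ->
  (specht_space F l :=: cyclic_mx rho (e tau))%MS.
Proof.
move=> fill_tau; apply/eqmxP/andP; split.
  apply/sumsmx_subP=> t tab_t; apply: cyclic_mx_sub; first exact: cyclic_mx_module.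
  have [sigma [fill_sigma sigmaE]] := tableau_filling tab_t.
  rewrite (polytabloid_filling tab_t sigmaE).
  have [g /eq_filling_polytabloid ->] := filling_conj fill_tau fill_sigma.
  rewrite -filling_polytabloidJ; apply: mxmodule_trans (cyclic_mx_id _ _); rewrite ?inE //.
  exact: cyclic_mx_module.
have [t tab_t] := tableau_exists l.
have [sigma [fill_sigma sigmaE]] := tableau_filling tab_t.
apply: (sumsmx_sup t tab_t); rewrite (polytabloid_filling tab_t sigmaE).
apply: cyclic_mx_sub; first exact: cyclic_mx_module.
have [g /eq_filling_polytabloid ->] := filling_conj fill_sigma fill_tau.
rewrite -filling_polytabloidJ; apply: mxmodule_trans (cyclic_mx_id _ _); rewrite ?inE //.
exact: cyclic_mx_module.
Qed.

Lemma filling_polytabloid_sub l tau : filling l tau -> (e tau <= specht_space F l)%MS.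
Proof. by move=> fill_tau; rewrite (specht_spaceE fill_tau) cyclic_mx_id. Qed.

Lemma specht_space_sum l tau (v : 'rV_#|{: tabloid b 'I_b}|) :
  filling l tau -> (v <= specht_space F l)%MS ->
  exists a : 'S_b -> F, v = \sum_g a g *: e (fun x => tau ((g^-1)%g x)).
Proof.
move=> fill_tau; rewrite (specht_spaceE fill_tau) => /cyclic_mxP[_ /envelop_mxP[a ->] ->].
exists a; rewrite mulmx_sumr; apply: eq_big => [g|g _]; first by rewrite inE.
by rewrite -scalemxAr filling_polytabloidJ.
Qed.

Lemma filling_comp l tau g : filling l tau -> filling l (fun x => tau (g x)).
Proof. by case=> tau_inj tau_l; split=> // x y /tau_inj/perm_inj. Qed.

Lemma specht_space_col_antisym l tau (v : 'rV_#|{: tabloid b 'I_b}|) :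
  filling l tau -> (v <= specht_space F l)%MS ->
  (v *m col_antisym rho tau <= e tau)%MS.
Proof.
move=> fill_tau /(specht_space_sum fill_tau)[a ->].
rewrite mulmx_suml summx_sub // => g _; rewrite -scalemxAl scalemx_sub //.
rewrite filling_polytabloidE mulmx_suml summx_sub // => p _.
rewrite -scalemxAl scalemx_sub //; apply/sub_rVP.
exact: (row_tabloid_col_antisym F0 fill_tau
  (filling_comp p^-1 (filling_comp g^-1 fill_tau))).
Qed.

(** Split off a submodule by Maschke. The antisymmetrizer maps the Specht module into the line of
    [e tau], so each of the two summands either contains [e tau], hence everything, or is killed.
    Both cannot be killed, since [e tau] is not. *)
Lemma specht_simple l : mxsimple rho (specht_space F l).
Proof.
have [tau fill_tau] := filling_exists l.
have e_neq0 := filling_polytabloid_neq0 F0 fill_tau.1.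
set U := specht_space F l; have modU : mxmodule rho U := specht_module F l.
have sub_eU W : mxmodule rho W -> (e tau <= W)%MS -> (U <= W)%MS.
  by move=> modW sub_eW; rewrite (specht_spaceE fill_tau) cyclic_mx_sub.
split=> // [|W modW sWU W_neq0].
  by apply: contraNneq e_neq0 => U0; rewrite -submx0 -U0 filling_polytabloid_sub.
have pcharG : [pchar F]^'.-group [set: 'S_b]
  by rewrite /pgroup pcharf'_nat pchar0_natf_neq0 ?cardG_gt0.
have := mx_Maschke_pchar rho pcharG.
move/(mx_reducibleS modU (submx1 _))/(_ W modW sWU) => [W' modW' defU dxU].
have sub_or X : mxmodule rho X -> (X <= U)%MS -> (e tau <= X)%MS \/
    forall u : 'rV_ _, (u <= X)%MS -> u *m col_antisym rho tau = 0.
  move=> modX sXU; have [|/negP not_sub] := boolP (e tau <= X)%MS; first by left.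
  right=> u sub_u.
  have /sub_rVP[a Da] := specht_space_col_antisym fill_tau (submx_trans sub_u sXU).
  rewrite Da; have [->|a_neq0] := eqVneq a 0; first by rewrite scale0r.
  case: not_sub; rewrite -(scale1r (e tau)) -(mulVf a_neq0) -scalerA -Da scalemx_sub //.
  rewrite mulmx_sumr summx_sub // => p _; rewrite -scalemxAr scalemx_sub //.
  by rewrite (mxmodule_trans modX) ?inE.
have sW'U : (W' <= U)%MS by rewrite -defU addsmxSr.
have [/(sub_eU _ _ modW)//|kW] := sub_or _ _ modW sWU.
have [/(sub_eU _ _ modW') sUW'|kW'] := sub_or _ _ modW' sW'U.
  case/eqP: W_neq0; apply/eqP.
  rewrite -submx0 -(mxdirect_addsP dxU) sub_capmx submx_refl /=.
  exact: submx_trans sWU sUW'.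
have: (e tau <= W + W')%MS by rewrite defU filling_polytabloid_sub.
case/sub_addsmxP=> [[u u'] /= De]; case/eqP: e_neq0.
have: e tau *m col_antisym rho tau = 0.
  by rewrite De mulmxDl kW ?kW' ?submxMl ?addr0.
rewrite /e -mulmxA col_antisym_idem -scalemxAr => /eqP; rewrite scaler_eq0.
by rewrite (negPf (pchar0_natf_neq0 F0 (cardG_gt0 _))) /= => /eqP.
Qed.

Lemma specht_irr l : mx_irreducible (specht F l).
Proof. exact/submod_mx_irr/specht_simple. Qed.

Lemma val_specht_sum l n (A : 'M_(n, _)) (P : pred 'S_b) (a : 'S_b -> F) :
  val_submod (A *m \sum_(g | P g) a g *: specht F l g) =
  val_submod A *m (\sum_(g | P g) a g *: rho g).
Proof.
rewrite !mulmx_sumr linear_sum; apply: eq_bigr => g _.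
by rewrite -!scalemxAr linearZ /= val_submodJ ?inE.
Qed.

Lemma val_specht_col_antisym l n (A : 'M_(n, _)) tau :
  val_submod (A *m col_antisym (specht F l) tau) = val_submod A *m col_antisym rho tau.
Proof. exact: val_specht_sum. Qed.

Lemma val_specht_row_sym l n (A : 'M_(n, _)) tau :
  val_submod (A *m row_sym (specht F l) tau) = val_submod A *m row_sym rho tau.
Proof.
have row_symE k (V : mx_representation F [set: 'S_b] k) :
    row_sym V tau = \sum_(p in R tau) 1 *: V p.
  by apply: eq_bigr => p _; rewrite scale1r.
by rewrite !row_symE val_specht_sum.
Qed.

(** The translates of [e sigma] span the Specht module, so an operator that is nonzero on it is
    nonzero on one of them. *)
Lemma specht_sum_neq0 l (X : 'M_(\rank (specht_space F l)))
    (Y : 'M_#|{: tabloid b 'I_b}|) sigma :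
  filling l sigma -> (forall n (A : 'M_(n, _)), val_submod (A *m X) = val_submod A *m Y) ->
  X != 0 -> [exists g : 'S_b, e (fun x => sigma ((g^-1)%g x)) *m Y != 0].
Proof.
move=> fill_sigma valX; apply: contraNT => /existsPn eY0.
have := valX _ 1%:M; rewrite mul1mx => valX1.
apply/eqP/(can_inj (val_submodK (U := specht_space F l))); rewrite linear0 valX1.
apply/row_matrixP=> i; rewrite row_mul row0.
have [|a ->] := @specht_space_sum l sigma (row i (val_submod 1%:M)) fill_sigma.
  by rewrite (submx_trans (row_sub _ _)) ?val_submod1.
rewrite mulmx_suml big1 // => g _; rewrite -scalemxAl.
by have /negPn/eqP -> := eY0 g; rewrite scaler0.
Qed.

(** Some tabloid of shape [m] survives the antisymmetrizer, and by [row_tabloid_col_antisym0] only a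
    transverse one can. *)
Lemma col_antisym_specht l m tau : filling l tau -> col_antisym (specht F m) tau != 0 ->
  exists2 sigma, filling m sigma & transverse tau sigma.
Proof.
move=> fill_tau; have [sigma fill_sigma] := filling_exists m.
case/(specht_sum_neq0 fill_sigma (fun n A => val_specht_col_antisym A tau))
  /existsP=> g e_neq0.
have [/existsP[p bv_neq0]|/existsPn bv0] := boolP [exists p : 'S_b,
  bv (fun x => sigma ((g^-1)%g ((p^-1)%g x))) *m col_antisym rho tau != 0].
  exists (fun x => sigma ((g^-1)%g ((p^-1)%g x))).
    exact: (filling_comp p^-1 (filling_comp g^-1 fill_sigma)).
  case: (transverseP tau (fun x => sigma ((g^-1)%g ((p^-1)%g x)))) =>
    // -[x [y [neq cxy rxy]]].
  by rewrite (row_tabloid_col_antisym0 F0 neq cxy) ?eqxx in bv_neq0.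
case/eqP: e_neq0; rewrite filling_polytabloidE mulmx_suml big1 // => p _.
by rewrite -scalemxAl; have /negPn/eqP -> := bv0 p; rewrite scaler0.
Qed.

Lemma row_sym_specht l m tau : filling l tau -> row_sym (specht F m) tau != 0 ->
  exists2 sigma, filling m sigma & transverse sigma tau.
Proof.
move=> fill_tau; have [sigma fill_sigma] := filling_exists m.
case/(specht_sum_neq0 fill_sigma (fun n A => val_specht_row_sym A tau))/existsP=> g e_neq0.
exists (fun x => sigma ((g^-1)%g x)); first exact: (filling_comp g^-1 fill_sigma).
case: (transverseP (fun x => sigma ((g^-1)%g x)) tau) => // -[x [y [neq cxy rxy]]].
by rewrite (filling_polytabloid_row_sym0 F0 neq rxy cxy) ?eqxx in e_neq0.
Qed.

Lemma col_antisym_specht_neq0 l tau : filling l tau -> col_antisym (specht F l) tau != 0.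
Proof.
move=> fill_tau; apply/eqP=> kap0.
have := val_specht_col_antisym (in_submod (specht_space F l) (e tau)) tau.
rewrite kap0 mulmx0 linear0 in_submodK ?filling_polytabloid_sub //.
rewrite /e -mulmxA col_antisym_idem -scalemxAr => /esym/eqP; rewrite scaler_eq0.
rewrite (negPf (pchar0_natf_neq0 F0 (cardG_gt0 _))) /=.
by apply/negP/filling_polytabloid_neq0; case: fill_tau.
Qed.

Lemma row_sym_specht_neq0 l tau : filling l tau -> row_sym (specht F l) tau != 0.
Proof.
move=> fill_tau; apply/eqP=> sym0.
have := val_specht_row_sym (in_submod (specht_space F l) (e tau)) tau.
rewrite sym0 mulmx0 linear0 in_submodK ?filling_polytabloid_sub // => e0.
have := filling_polytabloid_row_sym_coef F fill_tau.1.
rewrite -e0 mxE => /esym/eqP; apply/negP/(pchar0_natf_neq0 F0)/cardG_gt0.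
Qed.

Lemma specht_dominance l m tau :
  filling l tau -> col_antisym (specht F m) tau != 0 -> forall r,
  (\sum_(i : 'I_b | i < r) val m i <= \sum_(i : 'I_b | i < r) val l i)%N.
Proof.
move=> fill_tau /(col_antisym_specht fill_tau)[sigma fill_sigma tr] r.
exact: transverse_dominates fill_tau fill_sigma tr.
Qed.

(** The two conditions give opposite dominance inequalities between [l] and [m]. *)
Lemma specht_eq l m tau : filling l tau ->
  col_antisym (specht F m) tau != 0 -> row_sym (specht F m) tau != 0 -> m = l.
Proof.
move=> fill_tau col0 /(row_sym_specht fill_tau)[sigma fill_sigma tr].
apply: dominance_antisym => r; last exact: specht_dominance fill_tau col0 r.
exact: transverse_dominates fill_sigma fill_tau tr.
Qed.

(** An isomorphism preserves the non-vanishing of antisymmetrizers, so the shapes dominate each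
    other. *)
Lemma specht_rsim_eq l m : mx_rsim (specht F l) (specht F m) -> l = m.
Proof.
have sim_dom k k' : mx_rsim (specht F k) (specht F k') -> forall r,
    (\sum_(i : 'I_b | i < r) val k' i <= \sum_(i : 'I_b | i < r) val k i)%N.
  case/mx_rsim_def=> f [f' fK def_k] r; have [tau fill_tau] := filling_exists k.
  apply: (specht_dominance fill_tau); apply/eqP=> kap0.
  case/eqP: (col_antisym_specht_neq0 fill_tau).
  transitivity (f *m col_antisym (specht F k') tau *m f').
    rewrite mulmx_sumr mulmx_suml; apply: eq_bigr => p _.
    by rewrite def_k ?inE // -scalemxAr -scalemxAl.
  by rewrite kap0 mulmx0 mul0mx.
move=> sim; apply: dominance_antisym; first exact: sim_dom sim.
exact: sim_dom (mx_rsim_sym sim).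
Qed.

End SpechtIrreducibility.

(** * The dual twisted by the sign *)

Section DualTwist.

Variables (F : fieldType) (b n : nat) (rG : mx_representation F [set: 'S_b] n).

Definition sign_dual_mx (s : 'S_b) : 'M[F]_n := (-1) ^+ s *: (rG (s^-1)%g)^T.

Lemma sign_dual_mx_repr : mx_repr [set: 'S_b] sign_dual_mx.
Proof.
split=> [|s u _ _].
  by rewrite /sign_dual_mx odd_perm1 invg1 repr_mx1 trmx1 scale1r.
rewrite /sign_dual_mx invMg repr_mxM ?inE // trmx_mul odd_permM signr_addb.
by rewrite -scalemxAl -scalemxAr scalerA.
Qed.

Definition sign_dual := MxRepresentation sign_dual_mx_repr.

(** The annihilator [kermx U^T] of a submodule of the twisted dual is a submodule of the original
    module, hence zero or everything. *)
Lemma sign_dual_irr : mx_irreducible rG -> mx_irreducible sign_dual.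
Proof.
case/mx_irrP=> n_gt0 irrG; apply/mx_irrP; split=> // U modU U_neq0.
have modK : mxmodule rG (kermx U^T).
  apply/mxmoduleP=> s _; apply/sub_kermxP.
  have /submxP[D DU] : (U *m (rG s)^T <= U)%MS.
    have := mxmoduleP modU (s^-1)%g (in_setT _).
    rewrite /= /sign_dual_mx invgK odd_permV -scalemxAr.
    by rewrite (eqmx_scale _ (negbT (signr_eq0 _ _))).
  have -> : kermx U^T *m rG s *m U^T = kermx U^T *m (U *m (rG s)^T)^T.
    by rewrite trmx_mul trmxK mulmxA.
  by rewrite DU trmx_mul mulmxA mulmx_ker mul0mx.
have [K0|/(irrG _ modK)] := eqVneq (kermx U^T) 0.
  by rewrite /row_full -mxrank_tr -/(row_free U^T) -kermx_eq0 K0.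
rewrite -sub1mx => /sub_kermxP; rewrite mul1mx => /(congr1 trmx)/eqP.
by rewrite trmxK trmx0 (negPf U_neq0).
Qed.

Lemma col_antisym_sign_dual tau :
  col_antisym sign_dual tau = (row_sym rG (swap_filling tau))^T.
Proof.
rewrite linear_sum /= [RHS](reindex_inj invg_inj) /=.
apply: eq_big => [p|p _]; first by rewrite groupV !inE.
by rewrite /sign_dual_mx scalerA -signr_addb addbb scale1r.
Qed.

Lemma row_sym_sign_dual tau :
  row_sym sign_dual tau = (col_antisym rG (swap_filling tau))^T.
Proof.
rewrite linear_sum /= [RHS](reindex_inj invg_inj) /=.
apply: eq_big => [p|p _]; first by rewrite groupV !inE.
by rewrite /sign_dual_mx odd_permV linearZ.
Qed.

End DualTwist.

(** * Specht modules exhaust the irreducible modules *)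

Section SpechtComplete.

Variables (F : closedFieldType) (b : nat).
Hypothesis F0 : [pchar F] =i pred0.

Lemma pchar0_group (gT : finGroupType) (G : {group gT}) : [pchar F]^'.-group G.
Proof. by rewrite /pgroup pcharf'_nat pchar0_natf_neq0 ?cardG_gt0. Qed.

Local Notation G := [set: 'S_b]%G.
Let sG : irrType F G := DecSocleType (regular_repr F G).
Let comp (l : intpart b) : sG := irr_comp sG (specht F l).

Let comp_bij : bijective comp.
Proof.
have pcharG := pchar0_group G.
apply: inj_card_bij => [l m eq_lm|].
  apply: (specht_rsim_eq F0).
  apply: mx_rsim_trans (rsim_irr_comp_pchar sG pcharG (specht_irr F0 l)) _.
  rewrite -/(comp l) eq_lm; apply: mx_rsim_sym.
  exact: (rsim_irr_comp_pchar sG pcharG (specht_irr F0 m)).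
rewrite (card_irr_pchar sG pcharG) ?card_classes_perm //.
exact: group_closure_closed_field.
Qed.

Lemma irr_specht n (rG : mx_representation F G n) :
  mx_irreducible rG -> exists l, mx_rsim rG (specht F l).
Proof.
move=> irrG; have pcharG := pchar0_group G.
have [g gK compK] := comp_bij; exists (g (irr_comp sG rG)).
apply: mx_rsim_trans (rsim_irr_comp_pchar sG pcharG irrG) _.
have := rsim_irr_comp_pchar sG pcharG (specht_irr F0 (g (irr_comp sG rG))).
by rewrite -/(comp _) compK; apply: mx_rsim_sym.
Qed.

Lemma sum_specht_degree : (\sum_(l : intpart b) \rank (specht_space F l) ^ 2 = #|G|)%N.
Proof.
have pcharG := pchar0_group G.
rewrite -(sum_irr_degree_pchar sG pcharG); last exact: group_closure_closed_field.
rewrite (reindex comp) /=; last exact: onW_bij comp_bij.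
apply: eq_bigr => l _; congr (_ ^ 2)%N.
exact: (mxrank_rsim (rsim_irr_comp_pchar sG pcharG (specht_irr F0 l))).
Qed.

(** The regular module is a sum of simple modules, each isomorphic to a Specht module, so the
    element acts on it as zero. *)
Lemma specht_sum_eq0 (a : 'S_b -> F) :
  (forall l, \sum_s a s *: specht F l s = 0) -> forall s, a s = 0.
Proof.
move=> a0; set X : 'M[F]_(gcard G) := \sum_s a s *: regular_repr F G s.
have [I U /= simU defU _] := dec_mx_reducible_semisimple (mxmodule1 _)
  (mx_Maschke_pchar (regular_repr F G) (pchar0_group G)).
have UX0 i : U i *m X = 0.
  have modU := mxsimple_module (simU i).
  have [l /mx_rsim_def[f [f' _ homf]]] := irr_specht ((submod_mx_irr modU).2 (simU i)).
  have sum0 : \sum_s a s *: submod_repr modU s = 0.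
    transitivity (f *m (\sum_s a s *: specht F l s) *m f').
      rewrite mulmx_sumr mulmx_suml; apply: eq_bigr => s _.
      by rewrite homf ?inE // -scalemxAr -scalemxAl.
    by rewrite a0 mulmx0 mul0mx.
  have val0 : val_submod (1%:M : 'M_(\rank (U i))) *m X = 0.
    transitivity (val_submod (U := U i) (\sum_s a s *: submod_repr modU s)).
      rewrite mulmx_sumr [RHS]linear_sum; apply: eq_bigr => s _.
      rewrite -scalemxAr linearZ; congr (_ *: _).
      by rewrite -(val_submodJ modU) ?inE // mul1mx.
    by rewrite sum0 linear0.
  have : (U i *m X <= val_submod (1%:M : 'M_(\rank (U i))) *m X)%MS.
    by rewrite submxMr ?val_submod1.
  by case/submxP=> D ->; rewrite val0 mulmx0.
have X0 : X = 0.
  apply/eqP; rewrite -submx0 -[X]mul1mx -(eqmxMr _ defU) sumsmxMr.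
  by apply/sumsmx_subP=> i _; rewrite UX0 sub0mx.
(* [gring_proj] at [s] reads the coefficient of [s] off the regular representation. *)
move=> s; have := congr1 (@gring_proj F _ G s) X0.
rewrite linear_sum linear0 (bigD1 s) //= big1 => [|u neq_us].
  rewrite addr0 linearZ /= gring_projE ?inE // eqxx => /matrixP/(_ 0 0).
  by rewrite !mxE mulr1.
by rewrite linearZ /= gring_projE ?inE // eq_sym (negPf neq_us) scaler0.
Qed.

(** The twisted dual of $S^{l'}$ is some $S^m$. Twisting exchanges row symmetrizer and column
    antisymmetrizer, so neither vanishes on $S^m$ for the transposed filling of shape [l], and
    [specht_eq] gives $m = l$. *)
Lemma specht_conj_twist (l : intpart b) :
  exists J : 'M[F]_(\rank (specht_space F (conj_part l)), \rank (specht_space F l)),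
  [/\ \rank (specht_space F (conj_part l)) = \rank (specht_space F l), row_free J &
    forall s, (specht F (conj_part l) s)^T *m J = (-1) ^+ s *: (J *m specht F l (s^-1)%g)].
Proof.
have irrV := sign_dual_irr (specht_irr F0 (conj_part l)).
have [m sim_m] := irr_specht irrV.
have def_m : m = l.
  have [tau fill_tau] := filling_exists (conj_part l).
  have fill_l := swap_filling_conj fill_tau.
  have [f [f' fK def_V]] := mx_rsim_def sim_m.
  have ne0 (X : 'M_(_)) (Y : 'M_(_)) : X = f *m Y *m f' -> X != 0 -> Y != 0.
    by move=> ->; apply: contraNneq => ->; rewrite mulmx0 mul0mx.
  apply: (specht_eq F0 fill_l).
    apply: (ne0 (col_antisym (sign_dual (specht F (conj_part l))) (swap_filling tau))).
      rewrite mulmx_sumr mulmx_suml; apply: eq_bigr => p _.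
      by rewrite def_V ?inE // -scalemxAr -scalemxAl.
    rewrite col_antisym_sign_dual trmx_eq0; exact: (row_sym_specht_neq0 F0 fill_tau).
  apply: (ne0 (row_sym (sign_dual (specht F (conj_part l))) (swap_filling tau))).
    rewrite mulmx_sumr mulmx_suml; apply: eq_bigr => p _.
    by rewrite def_V ?inE.
  rewrite row_sym_sign_dual trmx_eq0; exact: (col_antisym_specht_neq0 F0 fill_tau).
rewrite {m}def_m in sim_m; case: sim_m => J def_n freeJ homJ; exists J; split=> // s.
have := homJ (s^-1)%g (in_setT _); rewrite /= /sign_dual_mx invgK odd_permV => <-.
by rewrite -scalemxAl scalerA -signr_addb addbb scale1r.
Qed.

End SpechtComplete.

(** * The summand *)

Section Wreath.

Variables (a b : nat).
Hypothesis a_gt0 : (0 < a)%N.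
Local Notation m := (a * b)%N.
Local Notation W := (wreath a b).
Local Notation quo := (@wreath_quo a b).

Lemma block_of_subproof (x : 'I_m) : (x %/ a < b)%N.
Proof. by rewrite ltn_divLR // [(b * a)%N]mulnC. Qed.

Definition block_of (x : 'I_m) : 'I_b := Ordinal (block_of_subproof x).

Lemma mem_block x k : (x \in block a k) = (block_of x == k).
Proof. by rewrite inE -val_eqE. Qed.

Lemma block_entry_subproof (k : 'I_b) (i : 'I_a) : (k * a + i < m)%N.
Proof.
have /leq_trans -> // : (k * a + i < k.+1 * a)%N by rewrite mulSn addnC ltn_add2r.
by rewrite mulnC leq_pmul2l.
Qed.

Definition block_entry k i : 'I_m := Ordinal (block_entry_subproof k i).

Lemma block_of_entry k i : block_of (block_entry k i) = k.
Proof. by apply: val_inj; rewrite /= divnMDl // divn_small ?addn0. Qed.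

Lemma card_block (k : 'I_b) : #|block a k| = a.
Proof.
have <- : block_entry k @: setT = block a k.
  apply/setP=> x; rewrite mem_block; apply/imsetP/eqP=> [[i _ ->]|<-].
    exact: block_of_entry.
  exists (Ordinal (ltn_pmod x a_gt0)) => //.
  by apply: val_inj; rewrite /= -divn_eq.
by rewrite card_imset ?cardsT ?card_ord // => i j [/addnI/val_inj].
Qed.

(** The $i$-th letter of the $k$-th standard block goes to the $i$-th element of [Y k]. *)
Lemma blocks_transitive (Y : 'I_b -> {set 'I_m}) :
  (forall k, #|Y k| = a) -> (forall k k', k != k' -> [disjoint Y k & Y k']) ->
  exists g : 'S_m, forall k, g @: block a k = Y k.
Proof.
move=> cardY disY.
pose f x := nth x (enum (Y (block_of x))) (x %% a).
have szY k : size (enum (Y k)) = a by rewrite -cardE.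
have fY x : f x \in Y (block_of x) by rewrite -mem_enum mem_nth // szY ltn_mod.
have f_inj : injective f.
  move=> x y eq_f; have eq_b : block_of x = block_of y.
    apply/eqP; apply: contraT => /disY/disjoint_setI0/setP/(_ (f x)).
    by rewrite !inE fY eq_f fY.
  apply: val_inj => /=; rewrite (divn_eq x a) (divn_eq y a).
  have /(congr1 val) /= -> := eq_b; congr (_ + _)%N; apply/eqP.
  move/eqP: eq_f; rewrite /f eq_b (set_nth_default x y) ?szY ?ltn_mod //.
  by rewrite nth_uniq ?szY ?ltn_mod ?enum_uniq.
exists (perm f_inj) => k; apply/eqP; rewrite eqEcard card_imset; last exact: perm_inj.
rewrite cardY card_block leqnn andbT; apply/subsetP=> _ /imsetP[x /[!mem_block] /eqP <- ->].
by rewrite permE.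
Qed.

Lemma wreath_quo_eq (g : 'S_m) (s : 'S_b) :
  (forall k, g @: block a k = block a (s k)) -> g \in W /\ quo g = s.
Proof.
move=> gE; have Wg : g \in W.
  rewrite inE; apply/andP; split; first by rewrite inE.
  rewrite inE; apply/subsetP=> _ /imsetP[k _ ->]; rewrite inE /= setactE.
  have -> : [set 'P%act x g | x in block a k] = g @: block a k by apply: eq_imset.
  by rewrite gE imset_f.
split=> //; apply/permP=> k; apply: (block_inj a_gt0).
by rewrite -wreath_quoP.
Qed.

Lemma wreath_quo_surj (s : 'S_b) : exists w, (w \in W) && (quo w == s).
Proof.
have [||w wE] := @blocks_transitive (fun k => block a (s k)).
- by move=> k; rewrite card_block.
- move=> k k' neq_k; rewrite -setI_eq0; apply/eqP/setP=> x.
  rewrite in_setI in_set0 !mem_block; case: eqP => // ->.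
  by rewrite (inj_eq perm_inj) (negPf neq_k).
by have [Ww /eqP quo_w] := wreath_quo_eq wE; exists w; rewrite Ww.
Qed.

Definition wreath_lift s := xchoose (wreath_quo_surj s).

Lemma wreath_lift_in s : wreath_lift s \in W.
Proof. by have /andP[] := xchooseP (wreath_quo_surj s). Qed.

Lemma wreath_liftK : cancel wreath_lift quo.
Proof. by move=> s; have /andP[_ /eqP] := xchooseP (wreath_quo_surj s). Qed.

Local Notation c := #|rcosets W [set: 'S_m]|.

(* Representatives of the right cosets of the kernel of quo in S_m. *)
Definition base_rep (z : 'I_c * 'S_b) : 'S_m := (wreath_lift z.2 * coset_elt z.1)%g.

Lemma base_rep_exists (g : 'S_m) :
  exists z, (g * (base_rep z)^-1 \in W)%g && (quo (g * (base_rep z)^-1)%g == 1%g).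
Proof.
have [i Wi] := coset_eltP W g; exists (i, quo (g * (coset_elt i)^-1)%g).
rewrite /base_rep /= invMg mulgA; set h := (g * _)%g.
have Wl : ((wreath_lift (quo h))^-1)%g \in W by rewrite groupV wreath_lift_in.
rewrite groupM //= (wreath_quoM Wi Wl).
rewrite (morphV (wreath_quo_morphism a b)) ?wreath_lift_in //=.
by rewrite wreath_liftK mulgV.
Qed.

Definition base_index g := xchoose (base_rep_exists g).

Lemma base_repK g :
  exists2 u, (u \in W) && (quo u == 1%g) & g = (u * base_rep (base_index g))%g.
Proof.
exists (g * (base_rep (base_index g))^-1)%g; last by rewrite mulgKV.
exact: xchooseP (base_rep_exists g).
Qed.

(** The quotient of the two representatives stabilizes every standard block, so it lies in the
    kernel of [quo]. *)
Lemma base_rep_inj z z' :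
  (forall k, base_rep z @: block a k = base_rep z' @: block a k) -> z = z'.
Proof.
move=> eq_bl; set u := (base_rep z * (base_rep z')^-1)%g.
have uE k : u @: block a k = block a ((1%g : 'S_b) k).
  rewrite perm1 -[RHS]imset_id.
  transitivity ((base_rep z')^-1%g @: (base_rep z @: block a k)).
    by rewrite -imset_comp; apply: eq_imset => x /=; rewrite permM.
  by rewrite eq_bl -imset_comp; apply: eq_imset => x /=; rewrite permK.
have [Wu quo_u] := wreath_quo_eq uE.
case: z z' @u eq_bl uE Wu quo_u => [i s] [i' s'] u _ _ Wu quo_u.
have Wi : (coset_elt i * (coset_elt i')^-1)%g \in W.
  move: Wu; rewrite /u /base_rep /= invMg mulgA groupMr ?groupV ?wreath_lift_in //.
  by rewrite -mulgA groupMl ?wreath_lift_in.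
have eq_i : i = i' by apply: (coset_elt_inj (x := coset_elt i)); rewrite ?mulgV ?group1.
congr (_, _) => //; rewrite -eq_i in u Wu quo_u.
move: quo_u; rewrite /u /base_rep /= invMg mulgA mulgK.
rewrite (wreath_quoM _ _) ?groupV ?wreath_lift_in //.
rewrite (morphV (wreath_quo_morphism a b)) ?wreath_lift_in //=.
by rewrite !wreath_liftK => /eqP; rewrite -eq_mulgV1 => /eqP.
Qed.

End Wreath.

(** * Polytabloids of one-column shape *)

Section ColumnPolytabloids.

Variables (F : fieldType) (b : nat) (A : finType).
Variable t : {ffun cell (ones b) -> 'I_b}.
Hypothesis tab_t : is_tableau t.

Local Notation e := (polytabloid F t).
Implicit Types X Y : {ffun 'I_b -> A}.

Lemma ones_cell (c : cell (ones b)) : (val c).2 = 0%N :> nat.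
Proof.
have := valP c; rewrite /= ffunE inordK ?ltnS ?(leq_ltn_trans _ (ltn_ord (val c).1)) //.
by case: (nat_of_ord _).
Qed.

Lemma ones_cell_inj (c d : cell (ones b)) : (val c).1 = (val d).1 -> c = d.
Proof.
move=> eq1; apply/val_inj/injective_projections => //.
by apply: val_inj; rewrite /= !ones_cell.
Qed.

Lemma col_stab_ones p : p \in col_stab t.
Proof.
have /andP[/injectiveP t_inj /'forall_existsP t_onto] := tab_t.
rewrite inE; apply/forallP=> j; have [j0|j_neq0] := eqVneq (nat_of_ord j) 0%N.
  have -> : [set t c | c : cell (ones b) & (val c).2 == j] = setT.
    apply/setP=> k; rewrite inE; have [c /eqP <-] := t_onto k.
    by apply: imset_f; rewrite inE -val_eqE /= ones_cell j0.
  by rewrite eqEcard subsetT card_imset ?leqnn //; apply: perm_inj.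
have -> : [set t c | c : cell (ones b) & (val c).2 == j] = set0.
  apply/setP=> k; rewrite inE; apply/negP => /imsetP[c].
  by rewrite inE -val_eqE /= ones_cell eq_sym (negPf j_neq0).
by rewrite imset0.
Qed.

Lemma polytabloid_onesE X :
  e X = \sum_(p : 'S_b) (-1) ^+ p *: basis_vec F (tabloid_of (fun c => X (p (t c)))).
Proof. by apply: eq_bigl => p; rewrite col_stab_ones. Qed.

(** With a single column every permutation is a column permutation; the sign twist of the summand
    comes from here. *)
Lemma polytabloid_ones_perm X (s : 'S_b) : e [ffun k => X (s k)] = (-1) ^+ s *: e X.
Proof.
rewrite !polytabloid_onesE scaler_sumr [RHS](reindex_inj (mulIg s)) /=.
apply: eq_bigr => p _; rewrite scalerA odd_permM signr_addb mulrCA -signr_addb addbb mulr1.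
congr (_ *: basis_vec _ _); apply/ffunP=> i; rewrite !ffunE.
by apply: eq_imset => c; rewrite ffunE permM.
Qed.

Lemma tabloid_of_ones_inj (f h : cell (ones b) -> A) :
  tabloid_of f = tabloid_of h -> f =1 h.
Proof.
move=> eq_fh c; move/ffunP/(_ (val c).1)/setP/(_ (f c)): eq_fh.
rewrite !ffunE imset_f ?inE // => /esym/imsetP[d]; rewrite inE => /eqP/ones_cell_inj <-.
by [].
Qed.

Lemma polytabloid_ones_coef X Y :
  e X 0 (enum_rank (tabloid_of (fun c => Y (t c)))) =
  \sum_(p : 'S_b) (-1) ^+ p *+ [forall k, X (p k) == Y k].
Proof.
have /andP[_ /'forall_existsP t_onto] := tab_t.
rewrite polytabloid_onesE summxE; apply: eq_bigr => p _.
rewrite !mxE eqxx (inj_eq enum_rank_inj) mulr_natr eq_sym; congr (_ *+ nat_of_bool _).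
apply/eqP/'forall_eqP=> [/tabloid_of_ones_inj eq_X k|eq_X].
  by have [c /eqP <-] := t_onto k; rewrite eq_X.
by apply/ffunP=> i; rewrite !ffunE; apply: eq_imset => c; rewrite eq_X.
Qed.

End ColumnPolytabloids.

(** * Set partitions attached to permutations *)

Section StandardTransversals.

Variables (a b : nat).
Hypothesis a_gt0 : (0 < a)%N.
Local Notation m := (a * b)%N.
Local Notation low := [set lshift m i | i : 'I_b].

(** From here on [a] plays the role of $a-1$: the sets of the partition have [a.+1] letters. *)
Definition transversal_of (g : 'S_m) : {ffun 'I_b -> {set 'I_(b + m)}} :=
  [ffun k => lshift m k |: @rshift b m @: (g @: block a k)].

Lemma low_transversal g k (i : 'I_b) : (lshift m i \in transversal_of g k) = (i == k).
Proof.
rewrite ffunE in_setU1 (inj_eq (@lshift_inj _ _)); apply: orb_idr => /imsetP[y _ /eqP].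
by rewrite eq_lrshift.
Qed.

Lemma high_transversal g k (y : 'I_m) :
  (rshift b y \in transversal_of g k) = (y \in g @: block a k).
Proof.
rewrite ffunE in_setU1 eq_rlshift /=; apply/imsetP/idP => [[z ? /rshift_inj ->]|] //.
by exists y.
Qed.

(** The set holding low letter [k] now holds [sigma k]. To index it by [sigma k], [w] must carry
    standard block [sigma k] to block [k], whence the inverse. *)
Lemma transversal_of_act g (sigma : 'S_b) (tau : 'S_m) w :
  w \in wreath a b -> wreath_quo w = (sigma^-1)%g ->
  [ffun k => ('P^*)%act (transversal_of g k) (young (sigma, tau))] =
  [ffun k => transversal_of (w * g * tau)%g (sigma k)].
Proof.
move=> Ww quo_w; apply/ffunP=> k; rewrite !ffunE /= setactE.
rewrite imsetU1 /= /aperm permE /young_fun (unsplitK (inl _)) /=; congr (_ |: _).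
have -> : (w * g * tau)%g @: block a (sigma k) = tau @: (g @: block a k).
  have <- : w @: block a (sigma k) = block a k.
    by rewrite wreath_quoP // quo_w permK.
  by rewrite -!imset_comp; apply: eq_imset => x; rewrite /= !permM.
rewrite -!imset_comp; apply: eq_imset => x /=.
by rewrite permE /young_fun (unsplitK (inr _)).
Qed.

Lemma transversal_of_ker (u g : 'S_m) : u \in wreath a b -> wreath_quo u = 1%g ->
  transversal_of (u * g)%g = transversal_of g.
Proof.
move=> Wu quo_u; apply/ffunP=> k; rewrite !ffunE.
have fix_k : u @: block a k = block a k by rewrite wreath_quoP // quo_u perm1.
suff -> : (u * g)%g @: block a k = g @: block a k by [].
by rewrite -[in RHS]fix_k -imset_comp; apply: eq_imset => x; rewrite /= permM.
Qed.

Lemma transversal_of_ordpart g :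
  @is_transversal_ordpart a.+1 b (transversal_of g).
Proof.
apply/andP; split; last first.
  apply/forallP=> k; apply/cards1P; exists (lshift m k); apply/setP=> x.
  rewrite in_setI in_set1; apply/andP/eqP=> [[xX /imsetP[i _ Dx]]|->].
    by move: xX; rewrite Dx low_transversal => /eqP->.
  by rewrite low_transversal eqxx imset_f.
apply/and3P; split.
- apply/forallP=> k; rewrite ffunE cardsU1 card_imset; last exact: rshift_inj.
  rewrite card_imset ?card_block //; last exact: perm_inj.
  suff -> : lshift m k \notin @rshift b m @: (g @: block a k) by [].
  by apply/imsetP=> -[y _ /eqP]; rewrite eq_lrshift.
- apply/forallP=> k; apply/forallP=> k'; apply/implyP=> neq_k.
  rewrite -setI_eq0; apply/eqP/setP=> x; rewrite in_setI in_set0; apply/negP=> /andP[].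
  case: (split_ordP x) => y ->; first by rewrite !low_transversal => /eqP-> ; apply/negP.
  rewrite !high_transversal => /imsetP[z Bz ->]; rewrite mem_imset; last exact: perm_inj.
  move: Bz; rewrite !(mem_block a_gt0) => /eqP->; exact/negP.
apply/eqP/setP=> x; rewrite inE; apply/bigcupP.
case: (split_ordP x) => y ->; first by exists y; rewrite // low_transversal.
exists (block_of a_gt0 ((g^-1)%g y)) => //; rewrite high_transversal.
by apply/imsetP; exists ((g^-1)%g y); rewrite ?(mem_block a_gt0) ?permKV.
Qed.

(** Reindex the sets by the low letter that each contains; the remaining letters form disjoint sets
    of size [a], to which [blocks_transitive] applies. *)
Lemma transversal_ordpartP X : @is_transversal_ordpart a.+1 b X ->
  exists (s : 'S_b) (g : 'S_m), [ffun k => X (s k)] = transversal_of g.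
Proof.
case/andP=> /and3P[/forallP cardX /'forall_'forall_implyP disX /eqP covX] /forallP lowX.
have ex k : exists j, lshift m k \in X j.
  have : lshift m k \in \bigcup_j X j by rewrite covX inE.
  by case/bigcupP=> j _; exists j.
pose f k := xchoose (ex k); have fP k : lshift m k \in X (f k) by apply: (xchooseP (ex k)).
have f_low k : X (f k) :&: low = [set lshift m k].
  have /cards1P[x Dx] := lowX (f k); rewrite Dx; congr [set _].
  by apply/esym/set1P; rewrite -Dx in_setI fP imset_f.
have f_inj : injective f.
  move=> j k eq_f; have := f_low j; rewrite eq_f f_low => /setP/(_ (lshift m j)).
  by rewrite !in_set1 eqxx (inj_eq (@lshift_inj _ _)) => /eqP.
pose Y k := [set y | rshift b y \in X (f k)].
have XE k : X (f k) = lshift m k |: @rshift b m @: Y k.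
  apply/setP=> x; rewrite in_setU1; case: (split_ordP x) => y ->.
    rewrite (inj_eq (@lshift_inj _ _)); have /setP/(_ (lshift m y)) := f_low k.
    rewrite in_setI imset_f // andbT in_set1 (inj_eq (@lshift_inj _ _)) => ->.
    by apply/esym/orb_idr => /imsetP[z _ /eqP]; rewrite eq_lrshift.
  by rewrite eq_rlshift mem_imset ?inE //; apply: rshift_inj.
have [||g gE] := blocks_transitive a_gt0 (Y := Y).
- move=> k; have := cardX (f k); rewrite XE cardsU1 card_imset; last exact: rshift_inj.
  suff -> : lshift m k \notin @rshift b m @: Y k by move/eqP; case.
  by apply/imsetP=> -[y _ /eqP]; rewrite eq_lrshift.
- move=> j k neq_jk; have := disX (f j) (f k); rewrite (inj_eq f_inj) neq_jk => /(_ isT).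
  rewrite -!setI_eq0 => /eqP dis; apply/eqP/setP=> y.
  by have /setP/(_ (rshift b y)) := dis; rewrite !in_setI !in_set0 !inE.
exists (perm f_inj), g; apply/ffunP=> k; rewrite !ffunE permE XE.
by rewrite gE.
Qed.

End StandardTransversals.

(** * Generators of both sides under one monomial rule *)

Section SummandDecomposition.

Variables (F : closedFieldType) (a b : nat).
Hypotheses (F0 : [pchar F] =i pred0) (a_gt0 : (0 < a)%N).
Local Notation m := (a * b)%N.
Local Notation W := (wreath a b).
Local Notation lift := (wreath_lift a_gt0).
Local Notation c := #|rcosets W [set: 'S_m]|.
Local Notation idx := ('I_c * 'S_b)%type.

(** Signed permutation of the cosets of the base group; it is the common source [M] for
    [mx_rsim_common]. *)
Definition monomial_mx (x : 'S_b * 'S_m) : 'M[F]_#|{: idx}| :=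
  \matrix_(z < #|{: idx}|) ((-1) ^+ x.1 *: delta_mx 0
    (enum_rank (base_index a_gt0 (lift (x.1^-1)%g * base_rep a_gt0 (enum_val z) * x.2)%g))).

Section GeneratorMatrix.

Variables (d : nat) (f : 'S_m -> 'rV[F]_d).
Variable rG : mx_representation F [set: 'S_b * 'S_m] d.
Hypothesis f_ker : forall u g, u \in W -> wreath_quo u = 1%g -> f (u * g)%g = f g.
Hypothesis f_act : forall s g h,
  f g *m rG (s, h) = (-1) ^+ s *: f (lift (s^-1)%g * g * h)%g.

Definition generator_mx : 'M[F]_(#|{: idx}|, d) :=
  \matrix_(z < #|{: idx}|) f (base_rep a_gt0 (enum_val z)).

Lemma row_generator_mx g : row (enum_rank (base_index a_gt0 g)) generator_mx = f g.
Proof.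
rewrite rowK enum_rankK; have [u /andP[Wu /eqP quo_u] {2}->] := base_repK a_gt0 g.
by rewrite f_ker.
Qed.

(** Used twice: with [summand_gen] for the summand and with [target_gen] for each term of the
    sum. *)
Lemma monomial_mx_generator x : monomial_mx x *m generator_mx = generator_mx *m rG x.
Proof.
apply/row_matrixP=> z; rewrite !row_mul !rowK -scalemxAl -rowE row_generator_mx.
by case: x => s h; rewrite f_act.
Qed.

End GeneratorMatrix.

Section Tabloids.

Variable t : {ffun cell (ones b) -> 'I_b}.
Hypothesis tab_t : is_tableau t.

Definition summand_gen (g : 'S_m) := polytabloid F t (transversal_of g).

Lemma summand_gen_ker u g :
  u \in W -> wreath_quo u = 1%g -> summand_gen (u * g)%g = summand_gen g.
Proof. by move=> Wu quo_u; rewrite /summand_gen transversal_of_ker. Qed.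

Lemma summand_gen_act s g h :
  summand_gen g *m foulkes_restr F a.+1 b (s, h) =
  (-1) ^+ s *: summand_gen (lift (s^-1)%g * g * h)%g.
Proof.
rewrite /summand_gen /= polytabloidJ -polytabloid_ones_perm //; congr polytabloid.
by apply: (transversal_of_act a_gt0); rewrite ?wreath_lift_in ?wreath_liftK.
Qed.

Local Notation B := (generator_mx summand_gen).

(** Read the coefficient at the tabloid of one chosen generator: the low letters force the
    permutation to be 1, then the high letters force the same coset by [base_rep_inj]. *)
Lemma summand_gen_free : row_free B.
Proof.
rewrite -kermx_eq0; apply/rowV0P=> u /sub_kermxP uB0.
apply/rowP=> z; rewrite mxE; pose T0 := transversal_of (base_rep a_gt0 (enum_val z)).
have := congr1 (fun v : 'rV_ _ => v 0 (enum_rank (tabloid_of (fun k => T0 (t k))))) uB0.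
rewrite mulmx_sum_row summxE mxE (bigD1 z) //= big1 => [|z' neq_z].
  rewrite addr0 mxE rowK polytabloid_ones_coef // (bigD1 1%g) //= big1 => [|p neq_p].
    rewrite odd_perm1 (_ : [forall k, _] = true) ?addr0 ?mulr1 //.
    by apply/'forall_eqP=> k; rewrite perm1.
  case: forallP => // eq_T; case/eqP: neq_p; apply/permP=> k; rewrite perm1.
  have := low_transversal (base_rep a_gt0 (enum_val z)) k k.
  by have /eqP <- := eq_T k; rewrite low_transversal eqxx => /eqP <-.
rewrite mxE rowK polytabloid_ones_coef // big1 ?mulr0 // => p _.
case: forallP => // eq_T; case/eqP: neq_z; apply/enum_val_inj/base_rep_inj=> k.
have pk j : p j = j.
  have := low_transversal (base_rep a_gt0 (enum_val z)) j j.
  by have /eqP <- := eq_T j; rewrite low_transversal eqxx => /eqP <-.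
apply/setP=> y; rewrite -!high_transversal; have /eqP/setP := eq_T k.
by rewrite pk => ->.
Qed.

(** Reordering the sets of a transversal partition only changes the sign of its polytabloid, so the
    standard ones suffice. *)
Lemma summand_gen_span : (B :=: summand_space F a.+1 t)%MS.
Proof.
have homB := monomial_mx_generator summand_gen_ker summand_gen_act.
apply/eqmxP/andP; split.
  apply/row_subP=> z; rewrite rowK.
  apply: (sumsmx_sup _ (transversal_of_ordpart a_gt0 (base_rep a_gt0 (enum_val z)))).
  exact: cyclic_mx_id.
apply/sumsmx_subP=> X /(transversal_ordpartP a_gt0)[s [g Xs]].
apply: cyclic_mx_sub; first by apply/mxmoduleP=> x _; rewrite -homB submxMl.
rewrite -(eqmx_scale _ (negbT (signr_eq0 _ s))) -polytabloid_ones_perm // Xs.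
by rewrite -[polytabloid _ _ _](row_generator_mx summand_gen_ker g) row_sub.
Qed.

End Tabloids.

Section Target.

Variable l : intpart b.
Local Notation n := (\rank (specht_space F l)).
Local Notation n' := (\rank (specht_space F (conj_part l))).
Variable J : 'M[F]_(n', n).
Hypothesis J_twist : forall s,
  (specht F (conj_part l) s)^T *m J = (-1) ^+ s *: (J *m specht F l (s^-1)%g).
Local Notation rH := (pullback_repr (wreath_quo_morphism a b) (specht F l)).

(** The tensor of [J], with its second factor sent into the induced module by $m \mapsto m \otimes
    g$. *)
Definition target_gen (g : 'S_m) : 'rV[F]_(n' * \sum_(i < c) n) :=
  flat_mx (J *m ind_gen rH g).

Lemma target_gen_ker u g :
  u \in W -> wreath_quo u = 1%g -> target_gen (u * g)%g = target_gen g.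
Proof.
move=> Wu quo_u; rewrite /target_gen ind_genM //= quo_u.
by rewrite (repr_mx1 (specht F l)) mul1mx.
Qed.

(** [J_twist] carries [s] on the first factor to the inverse of [s] on the second, up to sign;
    [ind_genM] then absorbs it as a lift to the wreath product. *)
Lemma target_gen_act s g h :
  target_gen g *m outer_repr (specht F (conj_part l)) (foulkes F a l) (s, h) =
  (-1) ^+ s *: target_gen (lift (s^-1)%g * g * h)%g.
Proof.
rewrite /target_gen [_ (s, h)]/= flat_mx_tprod -[RHS]linearZ; congr flat_mx.
have -> : ind_gen rH (lift (s^-1)%g * g * h)%g =
    specht F l (s^-1)%g *m ind_gen rH (g * h)%g.
  rewrite -mulgA (ind_genM _ _ (wreath_lift_in a_gt0 (s^-1)%g)).
  rewrite -[in RHS](wreath_liftK a_gt0 (s^-1)%g).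
  by [].
rewrite -[LHS]mulmxA -(mulmxA J) [ind_gen _ _ *m _]ind_genJ mulmxA [_^T *m J]J_twist.
by rewrite -scalemxAl -(mulmxA J).
Qed.

End Target.

End SummandDecomposition.

(** * The decomposition and the case of blocks of size one *)

Section Decomposition.

Variables (F : closedFieldType) (b : nat).
Hypothesis F0 : [pchar F] =i pred0.

Lemma summand_decomposition a (t : {ffun cell (ones b) -> 'I_b}) :
  (0 < a)%N -> is_tableau t ->
  mx_rsim (summand F a.+1 t)
    (\big[dadd_grepr/grepr0]_(l : intpart b)
      Representation (outer_repr (specht F (conj_part l)) (foulkes F a l))).
Proof.
move=> a_gt0 tab_t.
(* The properties are stated as a boolean so that [xchoose] can select one [J] for every [l]. *)
have exJ (l : intpart b) :
    exists J : 'M[F]_(\rank (specht_space F (conj_part l)), \rank (specht_space F l)),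
    [&& \rank (specht_space F (conj_part l)) == \rank (specht_space F l), row_free J &
    [forall s, (specht F (conj_part l) s)^T *m J ==
      (-1) ^+ s *: (J *m specht F l (s^-1)%g)]].
  have [J [/eqP eq_n freeJ twistJ]] := specht_conj_twist F0 l.
  by exists J; rewrite eq_n freeJ; apply/'forall_eqP.
pose J (l : intpart b) := xchoose (exJ l).
have twistJ (l : intpart b) s :
    (specht F (conj_part l) s)^T *m J l = (-1) ^+ s *: (J l *m specht F l (s^-1)%g).
  by have /and3P[_ _ /'forall_eqP->] := xchooseP (exJ l).
have eq_rank (l : intpart b) :
    \rank (specht_space F (conj_part l)) = \rank (specht_space F l).
  by have /and3P[/eqP] := xchooseP (exJ l).
pose P (l : intpart b) := generator_mx a_gt0 (target_gen (a := a) (J l)).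
have [|Q homQ injQ] := @dsum_intertwine F _ [set: 'S_b * 'S_(a * b)]%G
  (intpart b) (index_enum _)
  (fun l => Representation (outer_repr (specht F (conj_part l)) (foulkes F a l)))
  _ (monomial_mx F a_gt0) P.
  move=> l x _; apply: monomial_mx_generator; [exact: target_gen_ker|exact: target_gen_act].
apply: (mx_rsim_common _ (summand_gen_span F a_gt0 tab_t) (summand_gen_free F a_gt0 tab_t)
  (M := monomial_mx F a_gt0)) homQ.
- by move=> x _;
     apply: monomial_mx_generator; [exact: summand_gen_ker|exact: summand_gen_act].
(* With $c$ cosets of the wreath product and $f^l = \dim S^l$, the degrees are $c \cdot b!$ and
   $\sum_l f^{l'} c f^l$. *)
- rewrite rdegree_dsum /= card_prod card_ord -cardsT -(sum_specht_degree b F0) big_distrr /=.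
  apply: eq_bigr => l _; rewrite eq_rank sum_nat_const card_ord.
  by rewrite mulnCA.
rewrite -kermx_eq0; apply/rowV0P=> u /sub_kermxP/injQ uP0.
have uK (l : intpart b) :
    \sum_z u 0 z *: ind_gen (pullback_repr (wreath_quo_morphism a b) (specht F l))
    (base_rep a_gt0 (enum_val z)) = 0.
  have := uP0 l (mem_index_enum l); rewrite mulmx_sum_row => sum0.
  have fullJ : row_full (J l).
    by have /and3P[_ /eqP rankJ _] := xchooseP (exJ l); rewrite /row_full rankJ eq_rank.
  (* [J l] has full rank and [flat_mx] is injective, so both cancel. *)
  apply: (row_full_inj fullJ); rewrite mulmx0; apply: flat_mx_inj.
  rewrite linear0 -[RHS]sum0.
  rewrite mulmx_sumr linear_sum; apply: eq_bigr => z _ /=.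
  by rewrite rowK -scalemxAr linearZ.
apply/rowP=> z0; rewrite mxE.
pose i := (enum_val z0).1.
(* The coefficients over one coset [i] form an element of the group algebra, and block [i] of [uK]
   says that it kills every Specht module. *)
suff /(specht_sum_eq0 F0)/(_ (enum_val z0).2) : forall l,
    \sum_s u 0 (enum_rank (i, s)) *: specht F l s = 0.
  by rewrite -surjective_pairing enum_valK.
move=> l; have := congr1 (fun A => submxrow A i) (uK l).
rewrite submxrow0 submxrow_sum; apply: etrans.
transitivity (\sum_(z : 'I_#|rcosets (wreath a b) [set: 'S_(a * b)]| * 'S_b | z.1 == i)
    u 0 (enum_rank z) *: specht F l z.2).
  rewrite [RHS](reindex (fun s => (i, s))) /=; last first.
    by exists snd => [s|[j s]] //= /eqP<-.
  by apply: eq_bigl => s; rewrite eqxx.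
rewrite big_mkcond (reindex _ (onW_bij _ (enum_val_bij _))) /=.
apply: eq_bigr => z _; rewrite enum_valK.
rewrite -[X in submxrow X i]mul_scalar_mx -mul_submxrow mul_scalar_mx.
rewrite submxrow_ind_gen ?wreath_lift_in //=; case: eqP => _; last by rewrite scaler0.
by rewrite wreath_liftK.
Qed.

(** There is one coset. Its chosen representative may differ from 1, but the only block of
    [ind_gen rH 1] is still the invertible image of a group element. *)
Lemma ind_repr_full (gT : finGroupType) (H : {group gT}) n
    (rH : mx_representation F H n) (rG : mx_representation F [set: gT] n) :
  H :=: [set: gT] -> (forall x, rH x = rG x) -> mx_rsim rG (ind_repr rH).
Proof.
move=> defH eq_r; have [i Hi] := coset_eltP H 1%g.
exists (ind_gen rH 1%g) => [||x _].
- rewrite sum_nat_const card_ord.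
  have -> : #|rcosets H [set: gT]| = 1%N by rewrite -defH -[LHS]/(#|H : H|) indexgg.
  by rewrite mul1n.
- rewrite -kermx_eq0; apply/rowV0P=> u /sub_kermxP uK0.
  have: submxrow (u *m ind_gen rH 1%g) i = 0 by rewrite uK0 submxrow0.
  rewrite -mul_submxrow -{1}(mulgKV (coset_elt i) 1%g) submxrow_ind_gen // eqxx.
  by move/(canRL (repr_mxK rH Hi)); rewrite mul0mx.
by rewrite ind_genJ mul1g -[x in RHS]mulg1 ind_genM ?defH ?inE // eq_r.
Qed.

(** With blocks of size 1 the wreath product is the whole group, and the quotient map is the
    identification of [1 * b] with [b]. *)
Lemma foulkes1 (l : intpart b) :
  mx_rsim (foulkes F 1 l) (pullback_repr (morph_of_cast_perm (mul1n b)) (specht F l)).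
Proof.
have quoE (g : 'S_(1 * b)) : g \in wreath 1 b /\ wreath_quo g = cast_perm (mul1n b) g.
  apply: wreath_quo_eq => // k; apply/setP=> x; rewrite inE divn1.
  apply/imsetP/eqP=> [[y]|Dx].
    rewrite inE divn1 => /eqP Dy ->; rewrite cast_permE /=; congr (nat_of_ord (g _)).
    by apply: val_inj.
  exists ((g^-1)%g x); rewrite ?permKV // inE divn1.
  have -> : (g^-1)%g x = cast_ord (esym (mul1n b)) k; last by [].
  by apply: (@perm_inj _ g); rewrite permKV; apply: val_inj; rewrite /= Dx cast_permE.
apply: mx_rsim_sym; apply: ind_repr_full => [|x /=]; last by rewrite (quoE x).2.
by apply/setP=> g; rewrite (quoE g).1 inE.
Qed.

End Decomposition.

Theorem corollary3 (R : realType) (b : nat) (hb : (2 <= b)%N)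
    (t : {ffun cell (ones b) -> 'I_b}) (ht : is_tableau t) :
  (forall a : nat, (2 <= a)%N ->
     mx_rsim (summand R[i] a t)
       (\big[dadd_grepr/grepr0]_(l : intpart b)
          Representation
            (outer_repr (specht R[i] (conj_part l))
                        (foulkes R[i] a.-1 l))))
  /\
  mx_rsim (summand R[i] 2 t)
    (\big[dadd_grepr/grepr0]_(l : intpart b)
       Representation
         (outer_repr (specht R[i] (conj_part l))
                     (pullback_repr (morph_of_cast_perm (mul1n b))
                        (specht R[i] l)))).
Proof.
have C0 : [pchar R[i]] =i pred0 by apply: pchar_num.
split=> [[|[|a]] // _|]; first exact: summand_decomposition.
apply: mx_rsim_trans (summand_decomposition C0 (ltn0Sn 0) ht) _.
by apply: mx_rsim_dsum_congr => l; apply/mx_rsim_outer/foulkes1.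
Qed.
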